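(* Let $d\in\mathbb{N}$, $\alpha>0$, and let $\boldsymbol{Y}=(Y_{\boldsymbol{i}})_{\boldsymbol{i}\in\mathbb{Z}^d}$ be a random element of $\mathbb{R}^{\mathbb{Z}^d}_0=\{\boldsymbol{x}\in\mathbb{R}^{\mathbb{Z}^d}:|x_{\boldsymbol{0}}|>1\}$. Then $\boldsymbol{Y}$ is the tail process of some stationary regularly varying random field with tail index $\alpha$ if and only if $\boldsymbol{Y}$ is exceedance-stationary and $|Y_{\boldsymbol{0}}|$ is $\mathrm{Pareto}(\alpha)$-distributed and independent of $\boldsymbol{\Theta}:=\boldsymbol{Y}/|Y_{\boldsymbol{0}}|$.
   Context: $\mathrm{Pareto}(\alpha)$ means $\mathbb{P}(|Y_{\boldsymbol{0}}|>y)=y^{-\alpha}$ for $y\ge1$. $\mathbb{R}^{\mathbb{Z}^d}$ carries the product $\sigma$-algebra. For $\boldsymbol{k}\in\mathbb{Z}^d$ the shift is $\varphi_{\boldsymbol{k}}\boldsymbol{x}=(x_{\boldsymbol{i}+\boldsymbol{k}})_{\boldsymbol{i}\in\mathbb{Z}^d}$. The set of exceedance-points of $\boldsymbol{x}$ is $\mathrm{e}(\boldsymbol{x})=\{\boldsymbol{k}\in\mathbb{Z}^d:|x_{\boldsymbol{k}}|>1\}$. Tail process: a random field $\boldsymbol{Y}=(Y_{\boldsymbol{i}})_{\boldsymbol{i}\in\mathbb{Z}^d}$ is the tail process of a (strictly) stationary real-valued random field $\boldsymbol{X}=(X_{\boldsymbol{i}})_{\boldsymbol{i}\in\mathbb{Z}^d}$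 if $\mathbb{P}(|Y_{\boldsymbol{0}}|>1)=1$ and, for every $m\in\mathbb{N}$, the conditional distribution of $(u^{-1}X_{\boldsymbol{i}})_{\boldsymbol{i}\in\{-m,\dots,m\}^d}$ given $|X_{\boldsymbol{0}}|>u$ converges weakly, as $u\to\infty$, to the distribution of $(Y_{\boldsymbol{i}})_{\boldsymbol{i}\in\{-m,\dots,m\}^d}$. A stationary field admitting a tail process is called regularly varying; it is known that then $|Y_{\boldsymbol{0}}|$ is $\mathrm{Pareto}(\alpha)$-distributed for some $\alpha>0$, called the tail index, and that $|Y_{\boldsymbol 0}|$ is independent of $\boldsymbol{Y}/|Y_{\boldsymbol 0}|$. Exceedance-maps: let $B\subseteq\mathbb{R}^{\mathbb{Z}^d}_0$ be a Borel set such that $\boldsymbol{x}\in B$ and $\boldsymbol{k}\in\mathrm{e}(\boldsymbol{x})$ imply $\varphi_{\boldsymbol{k}}\boldsymbol{x}\in B$. A measurable map $\tau:B\to\mathbb{Z}^d$ is an exceedance-map on $B$ if $\tau(\boldsymbol{x})\in\mathrm{e}(\boldsymbol{x})$ for all $\boldsymbol{x}\in B$. It is bijective on $B$ if, for every $\boldsymbol{x}\in B$, the map $\boldsymbol{k}\mapsto\boldsymbol{k}+\tau(\varphi_{\boldsymbol{k}}\boldsymbol{x})$ is a bijection of $\mathrm{e}(\boldsymbol{x})$ onto itself. The associated exceedance-shift is $\varphi_\tau\boldsymbol{x}:=\varphi_{\tau(\boldsymbol{x})}\boldsymbol{x}$. For a random element $\boldsymbol{Y}$ of $\mathbb{R}^{\mathbb{Z}^d}_0$,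 an exceedance-map is $\boldsymbol{Y}$-bijective if it is bijective on some Borel set $B\subseteq\mathbb{R}^{\mathbb{Z}^d}_0$ such that $\boldsymbol{x}\in B$ and $\boldsymbol{k}\in\mathrm{e}(\boldsymbol{x})$ imply $\varphi_{\boldsymbol{k}}\boldsymbol{x}\in B$, and such that $\mathbb{P}(\boldsymbol{Y}\in B)=1$. A random element $\boldsymbol{Y}$ of $\mathbb{R}^{\mathbb{Z}^d}_0$ is exceedance-stationary if $\varphi_\tau\boldsymbol{Y}$ and $\boldsymbol{Y}$ have the same distribution for every $\boldsymbol{Y}$-bijective exceedance-map $\tau$. *)

(* Defs.v *)
From HB Require Import structures.
From mathcomp Require Import all_boot all_order all_algebra.
From mathcomp Require Import all_classical all_reals all_analysis.

Set Implicit Arguments.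
Unset Strict Implicit.
Unset Printing Implicit Defensive.

Import Order.TTheory GRing.Theory Num.Theory.
Import numFieldTopology.Exports numFieldNormedType.Exports.

Local Open Scope classical_set_scope.
Local Open Scope ring_scope.

Notation lattice d := 'rV[int]_d.

Section Fields.
Context {R : realType} {d : nat}.

Definition cylinders : set (set (lattice d -> R)) :=
  [set C | exists k : lattice d, exists2 A : set R,
     measurable A & C = [set x | A (x k)]].

(* R^(Z^d) with the product sigma-algebra *)
Definition field := g_sigma_algebraType cylinders.

(* R^(Z^d)_0, as a subset of R^(Z^d); its Borel subsets are the measurable
   subsets of R^(Z^d) that are included in it *)
Definition field0 : set field := [set x | 1 < `|x 0|].

Definition shift (k : lattice d) (x : field) : field := fun i => x (i + k).

Definition exceedances (x : field) : set (lattice d) := [set k | 1 < `|x k|].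

End Fields.
Arguments field R d : clear implicits.

Section RandomFields.
Context {R : realType} {d : nat}.
Context {dT : measure_display} {T : measurableType dT} (P : probability T R).

Definition stationary (X : {RV P >-> field R d}) : Prop :=
  forall (k : lattice d) (A : set (field R d)), measurable A ->
    P [set w | A (shift k (X w))] = P [set w | A (X w)].

Definition pareto (alpha : R) (X : T -> R) : Prop :=
  forall y : R, 1 <= y -> P [set w | y < X w] = (y `^ (- alpha))%:E.

Definition independent (X : T -> R) (Z : T -> field R d) : Prop :=
  forall (A : set R) (B : set (field R d)), measurable A -> measurable B ->
    P [set w | A (X w) /\ B (Z w)] =
      (P [set w | A (X w)] * P [set w | B (Z w)])%E.

Definition spectral (Y : T -> field R d) : T -> field R d :=
  fun w i => Y w i / `|Y w 0|.

End RandomFields.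

Section TailProcess.
Context {R : realType} {d : nat}.

Definition box (m : nat) := {k : lattice d | [forall j, `|k 0 j| <= m%:Z]}.

Definition restrict_box (m : nat) (x : field R d) : {ptws box m -> R} :=
  fun k => x (val k).
Arguments restrict_box m x : clear implicits.

(* Weak convergence is convergence of the integrals of the bounded continuous
   functions; [{ptws _ -> _}] carries the product topology.  The first conjunct
   makes the conditioning on [`|X 0| > u] meaningful for every [u]. *)
Definition tail_process
    {dX : measure_display} {TX : measurableType dX} (PX : probability TX R)
    (X : {RV PX >-> field R d})
    {dY : measure_display} {TY : measurableType dY} (PY : probability TY R)
    (Y : {RV PY >-> field R d}) : Prop :=
  [/\ forall u : R, (0 < PX [set w | (u < `|X w 0|)%R])%E,
      PY [set w | 1 < `|Y w 0|] = 1%E &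
      forall (m : nat) (f : {ptws box m -> R} -> R),
        continuous f -> (exists M : R, forall x, `|f x| <= M) ->
        (\int[PX]_(w in [set w | u < `|X w 0|])
            f (restrict_box m (fun i => u^-1 * X w i)))
          / fine (PX [set w | u < `|X w 0|]) @[u --> +oo]
        --> \int[PY]_w f (restrict_box m (Y w))].

(* The tail index is the Pareto exponent of [`|Y 0|], [Y] a tail process. *)
Definition regularly_varying (alpha : R)
    {dX : measure_display} {TX : measurableType dX} (PX : probability TX R)
    (X : {RV PX >-> field R d}) : Prop :=
  stationary X /\
  exists (dY : measure_display) (TY : measurableType dY)
         (PY : probability TY R) (Y : {RV PY >-> field R d}),
    tail_process X Y /\ pareto PY alpha (fun w => `|Y w 0|).

End TailProcess.

Section Exceedances.
Context {R : realType} {d : nat}.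
Implicit Types (B : set (field R d)) (tau : field R d -> lattice d).

Definition exceedance_domain B : Prop :=
  [/\ measurable B, B `<=` field0 &
      forall x k, B x -> exceedances x k -> B (shift k x)].

(* A map [B -> Z^d] is represented by a total function whose values outside [B]
   are irrelevant; it is measurable for the discrete sigma-algebra on [Z^d]. *)
Definition exceedance_map B tau : Prop :=
  (forall K : set (lattice d), measurable (B `&` tau @^-1` K)) /\
  (forall x, B x -> exceedances x (tau x)).

Definition bijective_on B tau : Prop :=
  forall x, B x ->
    set_bij (exceedances x) (exceedances x) (fun k => k + tau (shift k x)).

Definition exceedance_shift tau (x : field R d) : field R d := shift (tau x) x.

(* Given a Y-bijective exceedance-map, its restriction to the set [B] of full
   measure on which it is bijective is again an exceedance-map, so only such
   restrictions are considered.  As [tau] is arbitrary outside [B], the law of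
   [exceedance_shift tau Y] is taken on the almost sure event [Y \in B]. *)
Definition exceedance_stationary
    {dT : measure_display} {T : measurableType dT} (P : probability T R)
    (Y : {RV P >-> field R d}) : Prop :=
  forall B tau,
    exceedance_domain B -> exceedance_map B tau -> bijective_on B tau ->
    P [set w | B (Y w)] = 1%E ->
    forall A : set (field R d), measurable A ->
      P [set w | B (Y w) /\ A (exceedance_shift tau (Y w))] =
      P [set w | A (Y w)].

End Exceedances.

(* Main.v *)
From HB Require Import structures.
Require Import Defs.
From mathcomp Require Import all_boot all_order all_algebra.
From mathcomp Require Import all_classical all_reals all_analysis.
From mathcomp Require Import measurable_realfun.
From mathcomp Require Import zify ring lra.
Import Order.TTheory GRing.Theory Num.Theory.
Import numFieldTopology.Exports numFieldNormedType.Exports.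
(* Imported again because [shift] is also the name of a translation map in analysis. *)
Import Defs.

(** Both sides are equivalent to the conjunction of two identities for the law of
    [Y].  The first, [tail_homogeneous], says that for t >= 1 the part of the law
    of Y on {|Y_0| > t}, rescaled by t, is t^-alpha times the law of Y; it is the
    joint form of the Pareto law and of the independence.  The second,
    [shift_balanced], says that P(|Y_k| > 1, Y in D) is
    P(|Y_-k| > 1, phi_-k Y in D); it is equivalent to exceedance-stationarity.
    From the balance, a bijective exceedance-map is handled by cutting according
    to its value; conversely, the balance of a set D that is disjoint from its
    translate follows from the involution that exchanges the two, and up to
    k-periodic fields every set is a countable union of such sets.

    Let Y be the tail process of X.  For a test function that vanishes where
    |x_0| <= 1, the conditioning on |X_0| > u only affects the normalization.
    Hence stationarity of X, and the comparison of the levels u and u t, give exact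
    identities before the limit, and these converge to the balance and to the
    homogeneity ([tail_process_shift_balanced], [tail_process_tail_homogeneous]).

    Conversely, a stationary X is built from copies of Y.  On a finite torus with
    V points, put the origin of Y at a point k, keep only the values of Y on the
    fundamental domain, require that k be the first exceedance there, repeat the
    configuration periodically, and look at it from a point l.  Summing over k
    and l gives a finite stationary measure.  By the balance, the sum over k of
    the parts with an exceedance at l is exactly one copy of the law of Y, up to
    the periodization, which a box around l does not see unless l is near the
    boundary ([first_exceedance_sum], [torus_law_tail_ge]).  By homogeneity this
    holds at every level u >= 1.  The boundary effect is a fixed proportion for a
    fixed torus, so infinitely many tori are superposed: the j-th one, of slowly
    growing size, is stretched by a radius b_j and weighted so that its tail is
    u^-alpha for u >= b_j.  At the level u the n pieces with b_j <= u contribute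
    equally, with boundary proportions whose mean tends to 0, and the other
    pieces contribute at most 2 V_n u^-alpha, which is negligible because
    V_n = o(n) ([mixture_tail_le], [mixture_tail_ge], [dominance_cvg]).  The
    normalized superposition is the law of X ([exists_stationary_field]). *)

Set Implicit Arguments.
Unset Strict Implicit.
Unset Printing Implicit Defensive.

(** * Measures and random fields *)

Section Generalities.
Local Open Scope classical_set_scope.
Local Open Scope ring_scope.

Lemma measurable_preimageT d1 d2 (T1 : measurableType d1)
    (T2 : measurableType d2) (f : T1 -> T2) (A : set T2) :
  measurable_fun setT f -> measurable A -> measurable (f @^-1` A).
Proof. by move=> mf mA; rewrite -[X in measurable X]setTI; exact: mf. Qed.

(** For changes of variables that are defined piecewise, with a different shift on
    each piece. *)
Lemma measure_bigcup_eq (R : realType) d1 d2 (T1 : measurableType d1)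
    (T2 : measurableType d2) (mu1 : {measure set T1 -> \bar R})
    (mu2 : {measure set T2 -> \bar R}) (I : countType)
    (F : I -> set T1) (G : I -> set T2) :
  (forall i, measurable (F i)) -> (forall i, measurable (G i)) ->
  trivIset setT F -> trivIset setT G -> (forall i, mu1 (F i) = mu2 (G i)) ->
  mu1 (\bigcup_i F i) = mu2 (\bigcup_i G i).
Proof.
move=> mF mG tF tG FG.
pose ext T (H : I -> set T) n := if pickle_inv n is Some i then H i else set0.
have extE T (H : I -> set T) : \bigcup_i H i = \bigcup_n ext T H n.
  apply/seteqP; split=> [x [i _ Hx]|x [n _]].
    by exists (pickle i) => //; rewrite /ext pickleK_inv.
  by rewrite /ext; case: pickle_inv => // i Hx; exists i.
have text T (H : I -> set T) : trivIset setT H -> trivIset setT (ext T H).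
  move=> tH m n _ _ []; rewrite /ext.
  have := @pickle_invK I m; have := @pickle_invK I n.
  case: (pickle_inv n) => [j|] /= nE; case: (pickle_inv m) => [i|] /= mE x [];
    [|by []..].
  by move=> Hi Hj; rewrite -nE -mE (tH i j)//; exists x.
have mext d (T : measurableType d) (H : I -> set T) :
    (forall i, measurable (H i)) -> forall n, measurable (ext T H n).
  by move=> mH n; rewrite /ext; case: pickle_inv.
rewrite !extE !measure_semi_bigcup//;
  try solve [exact: mext | exact: text | apply: bigcup_measurable => n _; exact: mext].
by apply: eq_eseriesr => n _; rewrite /ext; case: pickle_inv; rewrite ?measure0.
Qed.

Lemma eq_measure_rays (R : realType) (m1 m2 : {measure set R -> \bar R}) :
  (m1 setT < +oo)%E -> m1 setT = m2 setT ->
  (forall y, m1 [set x | y < x] = m2 [set x | y < x]) ->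
  forall A : set R, measurable A -> m1 A = m2 A.
Proof.
move=> fin eqT eqr A mA.
(* the whole line is added to the rays to have a cover in the pi-system *)
pose G : set (set R) := setT |` [set A | exists x, A = `]x, +oo[%classic].
have rayE (x : R) : `]x, +oo[%classic = [set y | x < y].
  by apply/seteqP; split=> y /=; rewrite in_itv/= andbT.
apply: (measure_unique G (fun=> setT)) => //.
- rewrite [LHS]RGenOInfty.measurableE; apply/seteqP; split.
    by apply: sub_sigma_algebra2; exact: subsetUr.
  apply: smallest_sub; first exact: smallest_sigma_algebra.
  move=> B [->|]; last by move=> ?; exact: sub_sigma_algebra.
  case: (smallest_sigma_algebra setT (@RGenOInfty.G R)) => h0 hC _.
  by rewrite -(setD0 setT); exact: hC.
- move=> B C [->|[x ->]]; first by rewrite setTI.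
  move=> [->|[y ->]]; first by rewrite setIT; right; exists x.
  right; exists (Num.max x y); rewrite !rayE; apply/seteqP; split=> z /=.
    by move=> [xz yz]; rewrite gt_max xz.
  by rewrite gt_max => /andP[].
- by move=> _; left.
- by rewrite bigcup_const//.
- by move=> B [->//|[x ->]]; rewrite rayE.
Qed.

End Generalities.

Section FieldMeasurability.
Local Open Scope classical_set_scope.
Local Open Scope ring_scope.
Context {R : realType} {d : nat}.
Implicit Types (x : field R d) (k : lattice d).

Lemma measurable_coord k : measurable_fun setT (fun x => x k : R).
Proof.
move=> _ A mA; rewrite setTI; apply: sub_sigma_algebra.
by exists k; exists A.
Qed.

Lemma measurable_fun_field dT (T : measurableType dT) (f : T -> field R d) :
  (forall k, measurable_fun setT (fun w => f w k)) -> measurable_fun setT f.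
Proof.
move=> mf; apply: (@measurability _ _ T (field R d) setT f (@cylinders R d) erefl).
move=> _ [_ [k [A mA ->]] <-].
by apply: mf.
Qed.

Definition scale (c : R) x : field R d := fun i => c * x i.

Lemma measurable_shift k : measurable_fun setT (@shift R d k).
Proof. by apply: measurable_fun_field => i; exact: measurable_coord. Qed.

Lemma measurable_scale (c : R) : measurable_fun setT (scale c).
Proof.
apply: measurable_fun_field => i.
by apply: measurable_funM => //; exact: measurable_coord.
Qed.

Lemma measurable_exceed (c : R) k : measurable [set x : field R d | c < `|x k|].
Proof.
have mn : measurable_fun setT (fun x : field R d => `|x k|).
  by apply: measurableT_comp => //; exact: measurable_coord.
have -> : [set x : field R d | c < `|x k|] = (fun x => `|x k|) @^-1` `]c, +oo[.
  by apply/seteqP; split=> x /=; rewrite in_itv/= andbT.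
exact: measurable_preimageT.
Qed.

Lemma shift0 x : shift 0 x = x.
Proof. by apply/funext => i; rewrite /shift addr0. Qed.

Lemma shiftD k l x : shift k (shift l x) = shift (k + l) x.
Proof. by apply/funext => i; rewrite /shift -addrA. Qed.

Lemma shiftK k : cancel (@shift R d k) (shift (- k)).
Proof. by move=> x; rewrite shiftD addNr shift0. Qed.

Lemma shiftNK k : cancel (@shift R d (- k)) (shift k).
Proof. by move=> x; rewrite shiftD addrN shift0. Qed.

Lemma shift_at0 k x : shift k x 0 = x k.
Proof. by rewrite /shift add0r. Qed.

Lemma shiftN_atN k x : shift (- k) x k = x 0.
Proof. by rewrite /shift addrN. Qed.

Lemma scale_shift (c : R) k x : scale c (shift k x) = shift k (scale c x).
Proof. by []. Qed.

End FieldMeasurability.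

Section Rectangles.
Local Open Scope classical_set_scope.
Local Open Scope ring_scope.

Lemma eq_measure_rectangles (R : realType) d1 d2 (T1 : measurableType d1)
    (T2 : measurableType d2) (m1 m2 : {measure set (T1 * T2) -> \bar R}) :
  (m1 setT < +oo)%E ->
  (forall A B, measurable A -> measurable B -> m1 (A `*` B) = m2 (A `*` B)) ->
  forall X, measurable X -> m1 X = m2 X.
Proof.
move=> fin eqm X mX.
pose G : set (set (T1 * T2)) := [set A `*` B | A in measurable & B in measurable].
apply: (measure_unique G (fun=> setT)) => //.
- exact: measurable_prod_measurableType.
- move=> _ _ [A1 mA1 [B1 mB1 <-]] [A2 mA2 [B2 mB2 <-]].
  exists (A1 `&` A2); first exact: measurableI.
  by exists (B1 `&` B2); [exact: measurableI|rewrite setXI].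
- by move=> _; exists setT => //; exists setT => //; rewrite setXTT.
- by rewrite bigcup_const.
- by move=> _ [A mA [B mB <-]]; exact: eqm.
Qed.

End Rectangles.

Section RestrictedLaw.
Local Open Scope classical_set_scope.
Local Open Scope ring_scope.
Context d1 d2 (T1 : measurableType d1) (T2 : measurableType d2) (R : realType).
Variables (mu : {measure set T1 -> \bar R}) (f : T1 -> T2) (D : set T1).

(** The measurability proofs are arguments so that the measure structure is found
    by inference. *)
Definition law_on of measurable_fun setT f & measurable D : set T2 -> \bar R :=
  fun A => mu (f @^-1` A `&` D).

Hypotheses (mf : measurable_fun setT f) (mD : measurable D).

Let law_on0 : law_on mf mD set0 = 0%E.
Proof. by rewrite /law_on preimage_set0 set0I measure0. Qed.

Let law_on_ge0 A : (0 <= law_on mf mD A)%E. Proof. exact: measure_ge0. Qed.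

Let law_on_sigma_additive : semi_sigma_additive (law_on mf mD).
Proof.
move=> F mF tF mUF; rewrite /law_on preimage_bigcup setI_bigcupl.
have mfF n : measurable (f @^-1` F n `&` D).
  by apply: measurableI => //; exact: measurable_preimageT.
apply: measure_semi_sigma_additive => //; last exact: bigcup_measurable.
by move=> i j _ _ [t [[Fi _] [Fj _]]]; apply: tF => //; exists (f t).
Qed.

HB.instance Definition _ := isMeasure.Build _ _ _ (law_on mf mD)
  law_on0 law_on_ge0 law_on_sigma_additive.

End RestrictedLaw.

Lemma law_on_lty (R : realType) d1 d2 (T1 : measurableType d1)
    (T2 : measurableType d2) (P : probability T1 R) (f : T1 -> T2) (D : set T1)
    (mf : measurable_fun setT f) (mD : measurable D) :
  (law_on P mf mD setT < +oo)%E.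
Proof.
rewrite /law_on preimage_setT setTI.
exact: le_lt_trans (probability_le1 P mD) (ltry 1).
Qed.

(** * Polar decomposition of the tail process *)

Section PolarDecomposition.
Local Open Scope classical_set_scope.
Local Open Scope ring_scope.
Context {R : realType} {d : nat}.

Definition direction (x : field R d) : field R d := fun i => x i / `|x 0|.

Lemma measurable_fun_norm k : measurable_fun setT (fun x : field R d => `|x k|).
Proof. by apply: measurableT_comp => //; exact: measurable_coord. Qed.

(** [spectral Y] is [direction \o Y]; the direction forgets the scale, so events
    on it are the scale-invariant ones. *)
Lemma direction_scale (c : R) x : 0 < c -> direction (scale c x) = direction x.
Proof.
move=> c0; apply/funext => i; rewrite /direction /scale normrM gtr0_norm//.
by rewrite invfM mulrACA divff ?mul1r// gt_eqF.
Qed.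

Lemma scale_direction x : x 0 != 0 -> scale `|x 0| (direction x) = x.
Proof.
move=> x0; apply/funext => i; rewrite /direction /scale mulrC divfK//.
by rewrite normr_eq0.
Qed.

Lemma measurable_direction : measurable_fun setT direction.
Proof.
apply: measurable_fun_field => k; apply: measurable_funM.
  exact: measurable_coord.
(* the inverse is measurable as a power function *)
rewrite (_ : (fun x : field R d => _) =
    (fun r : R => r `^ (- 1)) \o (fun x : field R d => `|x 0|)).
  exact: (measurableT_comp (measurable_powR _) (measurable_fun_norm 0)).
by apply/funext => x; rewrite /= powR_inv1.
Qed.

Context {dT : measure_display} {T : measurableType dT}.
Context (P : probability T R) (Y : {RV P >-> field R d}).

(** One identity for the Pareto tail and for the independence of modulus and
    direction: passing to the level [t] amounts to a change of scale. *)
Definition tail_homogeneous (alpha : R) : Prop :=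
  forall (t : R) (C : set (field R d)), 1 <= t -> measurable C ->
    P [set w | t < `|Y w 0| /\ C (scale t^-1 (Y w))] =
      ((t `^ (- alpha))%:E * P [set w | C (Y w)])%E.

Hypothesis Y_field0 : forall w, field0 (Y w).
Context (alpha : R).

Let norm0 w := `|Y w 0|.

Let mnorm0 : measurable_fun setT norm0.
Proof. exact: (measurableT_comp (measurable_fun_norm 0) (measurable_funPT Y)). Qed.

Let mspec : measurable_fun setT (spectral Y).
Proof. exact: (measurableT_comp measurable_direction (measurable_funPT Y)). Qed.

Lemma tail_homogeneous_pareto :
  tail_homogeneous alpha -> pareto P alpha (fun w => `|Y w 0|).
Proof.
move=> H y y1; have := H y setT y1 measurableT.
rewrite (_ : [set w | setT (Y w)] = setT)// probability_setT mule1 => <-.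
by congr (P _); apply/seteqP; split=> w //= [].
Qed.

(** A direction event is scale-invariant, so homogeneity factors it from the rays
    [t < `|Y 0|]; these determine the law of the modulus. *)
Lemma tail_homogeneous_independent :
  tail_homogeneous alpha -> independent P (fun w => `|Y w 0|) (spectral Y).
Proof.
move=> H A B mA mB.
have mSB : measurable (spectral Y @^-1` B) by exact: measurable_preimageT.
have PBfin : P (spectral Y @^-1` B) \is a fin_num by exact: fin_num_measure.
pose c := NngNum (fine_ge0 (measure_ge0 P (spectral Y @^-1` B))).
have cE : (c%:num)%:E = P (spectral Y @^-1` B) by rewrite /c/= fineK.
suff eqA : law_on P mnorm0 mSB A = mscale c (law_on P mnorm0 measurableT) A.
  by move: eqA; rewrite /= /mscale/= /law_on setIT cE muleC.
apply: eq_measure_rays => //.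
- exact: law_on_lty.
- by rewrite /= /mscale/= /law_on cE setTI setIT preimage_setT probability_setT mule1.
move=> y; rewrite /= /mscale/= /law_on cE setIT muleC.
have [y1|y1] := leP 1 y; last first.
  rewrite (_ : norm0 @^-1` _ = setT) ?probability_setT ?mul1e ?setTI//.
  by apply/seteqP; split=> // w _ /=; apply: lt_trans y1 _; exact: Y_field0.
have mC : measurable (direction @^-1` B).
  by apply: measurable_preimageT => //; exact: measurable_direction.
have := H y _ y1 mC.
rewrite (tail_homogeneous_pareto H)// => <-; congr (P _).
have y0 : 0 < y^-1 by rewrite invr_gt0 (lt_le_trans _ y1).
by apply/seteqP; split=> w /= [yY];
  rewrite direction_scale.
Qed.

(** The pair (modulus / t, direction), restricted to [t < modulus], has a product
    law with the same direction marginal; the Pareto law is the one whose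
    conditional law above [t] is, after rescaling, itself.  So the restricted pair
    has [t `^ - alpha] times the law of the full pair, and [Y] is a measurable
    function of the pair. *)
Lemma pareto_independent_tail_homogeneous :
  pareto P alpha (fun w => `|Y w 0|) ->
  independent P (fun w => `|Y w 0|) (spectral Y) -> tail_homogeneous alpha.
Proof.
move=> par ind t C t1 mC.
have t0 : 0 < t by exact: lt_le_trans t1.
pose c := NngNum (powR_ge0 t (- alpha)).
pose U : set R := [set r | t < r].
have rayE (r : R) : `]r, +oo[%classic = [set y | r < y].
  by apply/seteqP; split=> y /=; rewrite in_itv/= andbT.
have mray (r : R) : measurable [set y : R | r < y] by rewrite -rayE.
have mU : measurable U by exact: mray.
have mD : measurable (norm0 @^-1` U) by exact: measurable_preimageT.
have mnt : measurable_fun setT (fun w => t^-1 * norm0 w).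
  exact: measurable_funM.
have pareto_all y : P (norm0 @^-1` [set r | y < r]) = ((Num.max 1 y) `^ (- alpha))%:E.
  have [y1|y1] := leP 1 y; first exact: par.
  rewrite powR1 (_ : _ @^-1` _ = setT) ?probability_setT//.
  by apply/seteqP; split=> // w _ /=; apply: lt_trans y1 _; exact: Y_field0.
(* the radial law above [t], rescaled by [t], is again Pareto *)
have radial A : measurable A ->
    law_on P mnt mD A = mscale c (law_on P mnorm0 measurableT) A.
  move=> mA; apply: eq_measure_rays => //.
  - exact: law_on_lty.
  - rewrite /= /mscale/= /law_on !preimage_setT !setTI probability_setT mule1.
    by rewrite (pareto_all t) max_r.
  move=> y; rewrite /= /mscale/= /law_on setIT pareto_all -EFinM /= -powRM; last 2 first.
  - exact: ltW.
  - by rewrite le_max ler01.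
  rewrite maxr_pMr ?(ltW t0)// mulr1.
  rewrite (_ : _ `&` _ = norm0 @^-1` [set r | Num.max t (t * y) < r]).
    by rewrite pareto_all max_r// le_max t1.
  apply/seteqP; split=> w /=; rewrite /U /=.
    by move=> []; rewrite ltr_pdivlMl// gt_max => -> ->.
  by rewrite gt_max => /andP[tw tyw]; rewrite ltr_pdivlMl.
have mrs : measurable_fun setT (fun w => (t^-1 * norm0 w, spectral Y w)).
  exact/measurable_fun_pairP.
have mps : measurable_fun setT (fun w => (norm0 w, spectral Y w)).
  exact/measurable_fun_pairP.
pose X := [set z : R * field R d | C (scale z.1 z.2)].
have mX : measurable X.
  apply: (@measurable_preimageT _ _ (R * field R d)%type _ (fun z => scale z.1 z.2)) => //.
  apply: measurable_fun_field => k; apply: measurable_funM => //.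
  exact: (measurableT_comp (measurable_coord k) measurable_snd).
have joint : law_on P mrs mD X = mscale c (law_on P mps measurableT) X.
  apply: eq_measure_rectangles mX => //; first exact: law_on_lty.
  move=> A B mA mB; rewrite /= /mscale /= /law_on setIT.
  have -> : P ((fun w => (norm0 w, spectral Y w)) @^-1` (A `*` B)) =
      (P (norm0 @^-1` A) * P (spectral Y @^-1` B))%E by exact: ind.
  have mA' : measurable ((fun r : R => t^-1 * r) @^-1` A `&` U).
    apply: measurableI => //; apply: measurable_preimageT => //.
    exact: measurable_funM.
  rewrite muleA; have := radial A mA; rewrite /= /mscale /= /law_on setIT => <-.
  rewrite -(ind _ _ mA' mB); congr (P _).
  by apply/seteqP; split=> w /=; rewrite /U /norm0/=; tauto.
move: joint; rewrite /= /mscale /= /law_on setIT.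
have Yfac w : scale (norm0 w) (spectral Y w) = Y w.
  apply: (scale_direction (x := Y w)); rewrite -normr_gt0.
  exact: lt_trans ltr01 (Y_field0 w).
have -> : (fun w => (norm0 w, spectral Y w)) @^-1` X = [set w | C (Y w)].
  by apply/seteqP; split=> w; rewrite /X/= Yfac.
move=> <-; congr (P _).
have Yfac' w : scale (t^-1 * norm0 w) (spectral Y w) = scale t^-1 (Y w).
  by rewrite -[in RHS](Yfac w); apply/funext => i; rewrite /scale mulrA.
by apply/seteqP; split=> w; rewrite /X/U/= Yfac'; tauto.
Qed.

End PolarDecomposition.

(** * Exceedance-stationarity and balance under shifts *)

Section ShiftBalance.
Local Open Scope classical_set_scope.
Local Open Scope ring_scope.
Context {R : realType} {d : nat} {dT : measure_display} {T : measurableType dT}.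
Context (P : probability T R) (Y : {RV P >-> field R d}).

(** Mass transport between the origin and [k]: seeing an exceedance at [k] from
    the origin weighs as much as seeing the origin from an exceedance at [- k].
    This is exceedance-stationarity with the bijective exceedance-maps replaced
    by single shifts. *)
Definition shift_balanced : Prop :=
  forall (k : lattice d) (D : set (field R d)), measurable D ->
    P [set w | 1 < `|Y w k| /\ D (Y w)] =
    P [set w | 1 < `|Y w (- k)| /\ D (shift (- k) (Y w))].

Hypothesis Y_field0 : forall w, field0 (Y w).

Lemma measurable_RV_preimage (f : field R d -> field R d) (D : set (field R d)) :
  measurable_fun setT f -> measurable D -> measurable [set w | D (f (Y w))].
Proof.
move=> mf mD; apply: (@measurable_preimageT _ _ _ _ (f \o Y)) => //.
by apply: measurableT_comp.
Qed.

Lemma measurable_RV (D : set (field R d)) :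
  measurable D -> measurable [set w | D (Y w)].
Proof. by move=> mD; apply: measurable_preimageT. Qed.

Lemma probability1_setI (A B : set T) : measurable A -> measurable B ->
  P B = 1%E -> P (B `&` A) = P A.
Proof.
move=> mA mB PB.
have PC : P (A `\` B) = 0%E.
  apply/eqP; rewrite eq_le measure_ge0 andbT.
  have := probability_setC P mB; rewrite PB subee// => <-.
  apply: le_measure; rewrite ?inE; [exact: measurableD|exact: measurableC|].
  by move=> w [].
transitivity (P (A `\` B) + P (A `&` B))%E; first by rewrite PC add0e setIC.
by apply/esym; exact: measureDI.
Qed.

(** Cut according to the value [k] of [tau] and move each piece back by [k].  The
    moved pieces are indexed by the exceedance points [- k] which the bijection
    [j |-> j + tau (shift j x)] maps to the origin, and there is exactly one, so
    they partition the event again. *)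
Lemma shift_balanced_exceedance_stationary :
  shift_balanced -> exceedance_stationary Y.
Proof.
move=> bal B tau [mB B0 Bshift] [mtau taue] bij PB A mA.
pose E k := [set w | [/\ B (Y w), tau (Y w) = k & A (shift k (Y w))]].
pose E' k := [set w | [/\ B (Y w), A (Y w), 1 < `|Y w (- k)|
                        & tau (shift (- k) (Y w)) = k]].
pose D k := [set x | B x /\ tau x = k] `&` [set x | A (shift k x)].
have mD k : measurable (D k).
  apply: measurableI; first exact: (mtau [set k]).
  by apply: measurable_preimageT => //; exact: measurable_shift.
have ED k : E k = [set w | 1 < `|Y w k| /\ D k (Y w)].
  apply/seteqP; split=> w /= => [[Bw tw Aw]|[_ [[Bw tw] Aw]]] //.
  by rewrite -{1}tw; split; [exact: (taue _ Bw)|].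
have E'D k : E' k = [set w | 1 < `|Y w (- k)| /\ D k (shift (- k) (Y w))].
  apply/seteqP; split=> w /= => [[Bw Aw kw tw]|[kw [[Bw tw]]]].
    by split=> //; rewrite /D/= shiftNK; split=> //; split=> //; exact: Bshift.
  rewrite /= shiftNK => Aw; split=> //.
  rewrite -[Y w](shiftNK k); apply: Bshift => //.
  by rewrite /exceedances /= shiftN_atN; exact: Y_field0.
have mN k : measurable [set x : field R d | 1 < `|x k|] by exact: measurable_exceed.
have mE k : measurable (E k).
  rewrite ED; apply: measurableI; first exact: (measurable_RV (mN k)).
  exact: (measurable_RV (mD k)).
have mE' k : measurable (E' k).
  rewrite E'D; apply: measurableI; first exact: (measurable_RV (mN (- k))).
  by apply: (measurable_RV_preimage _ (mD k)); exact: measurable_shift.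
have EU : \bigcup_k E k = [set w | B (Y w) /\ A (exceedance_shift tau (Y w))].
  apply/seteqP; split=> [w [k _ [Bw <- Aw]]|w [Bw Aw]] //.
  by exists (tau (Y w)).
have E'U : \bigcup_k E' k = [set w | B (Y w)] `&` [set w | A (Y w)].
  apply/seteqP; split=> [w [k _ [Bw Aw _ _]]|w [Bw Aw]] //.
  have [_ _ /(_ 0) []] := bij _ Bw.
    exact: Y_field0.
  move=> j jY j0; have jE : tau (shift j (Y w)) = - j.
    by apply/eqP; rewrite -addr_eq0 addrC j0.
  by exists (- j) => //; rewrite /E' /= opprK; split.
rewrite -EU (@measure_bigcup_eq _ _ _ _ _ P P _ E E') //.
- by rewrite E'U; apply: probability1_setI => //; exact: measurable_RV.
- by move=> k l _ _ [w [[_ <- _] [_ <- _]]].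
- move=> k l _ _ [w [[Bw _ kw tk] [_ _ lw tl]]].
  have [_ inj _] := bij _ Bw; apply: oppr_inj.
  by apply: inj; rewrite ?inE// tk tl !addNr.
- by move=> k; rewrite ED E'D; exact: bal.
Qed.

(** When [D] is disjoint from its translate by [k], exchanging the two and leaving
    everything else in place is an involutive exceedance-map. *)
Section Swap.
Context (k : lattice d) (D : set (field R d)).
Hypotheses (mD : measurable D) (D0 : D `<=` field0).
Hypotheses (Dk : forall x, D x -> 1 < `|x k|) (Dshift : forall x, D x -> ~ D (shift k x)).

Definition swap (x : field R d) : lattice d :=
  if `[< D x >] then k else if `[< D (shift (- k) x) >] then - k else 0.

Variant swap_spec (x : field R d) : lattice d -> Prop :=
| SwapFwd of D x : swap_spec x k
| SwapBwd of ~ D x & D (shift (- k) x) : swap_spec x (- k)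
| SwapId of ~ D x & ~ D (shift (- k) x) : swap_spec x 0.

Lemma swapP x : swap_spec x (swap x).
Proof.
rewrite /swap; case: asboolP => Dx; first exact: SwapFwd.
by case: asboolP => Dx'; [exact: SwapBwd|exact: SwapId].
Qed.

Lemma swap_exceed x : field0 x -> exceedances x (swap x).
Proof.
move=> x0; case: swapP => [/Dk//|_ /D0|//].
by rewrite /field0 /= shift_at0.
Qed.

Lemma swapK x : swap (shift (swap x) x) = - swap x.
Proof.
case: (swapP x) => [Dx|nDx Dx|nDx nDx'].
- case: swapP => [/(Dshift Dx)//|//|_]; by rewrite shiftK.
- by case: swapP => [_|/(_ Dx)//|/(_ Dx)//]; rewrite opprK.
- by rewrite shift0 oppr0; case: swapP => // Dx; case: nDx.
Qed.

Lemma measurable_swap (K : set (lattice d)) :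
  measurable (field0 `&` swap @^-1` K).
Proof.
have mprop (Q : Prop) : measurable [set x : field R d | Q].
  have [q|q] := pselect Q.
    by rewrite (_ : [set _ | _] = setT)//; apply/seteqP; split.
  by rewrite (_ : [set _ | _] = set0)//; apply/seteqP; split.
have mD' : measurable (shift (- k) @^-1` D).
  by apply: measurable_preimageT => //; exact: measurable_shift.
have -> : swap @^-1` K = (D `&` [set x | K k]) `|`
    ((~` D `&` (shift (- k) @^-1` D)) `&` [set x | K (- k)]) `|`
    ((~` D `&` ~` (shift (- k) @^-1` D)) `&` [set x | K 0]).
  apply/seteqP; split=> x /=; first by case: swapP; tauto.
  by case: swapP; tauto.
apply: measurableI; first exact: measurable_exceed.
apply: measurableU; first apply: measurableU.
- by apply: measurableI.
- by apply: measurableI => //; apply: measurableI => //; exact: measurableC.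
- by apply: measurableI => //; apply: measurableI => //; exact: measurableC.
Qed.

Lemma swap_bijective : bijective_on field0 swap.
Proof.
move=> x _; pose g j := j + swap (shift j x).
have gK : involutive g.
  by move=> j; rewrite /g [in shift (_ + _) _]addrC -shiftD swapK addrK.
have gE j : exceedances x j -> exceedances x (g j).
  move=> xj; have := @swap_exceed (shift j x); rewrite /field0 /= shift_at0.
  by move=> /(_ xj); rewrite /exceedances /= /shift addrC.
split.
- by move=> j; exact: gE.
- by move=> i j _ _; exact: (can_inj gK).
- by move=> j xj; exists (g j); [exact: gE|exact: gK].
Qed.

Lemma exceedance_stationary_swap : exceedance_stationary Y ->
  P [set w | D (Y w)] = P [set w | D (shift (- k) (Y w))].
Proof.
move=> es; pose A := shift (- k) @^-1` D.
have mA : measurable A.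
  by apply: measurable_preimageT => //; exact: measurable_shift.
have dom : exceedance_domain (@field0 R d).
  split=> //; first exact: measurable_exceed.
  by move=> x j _ xj; rewrite /field0 /= shift_at0.
have emap : exceedance_map field0 swap.
  by split; [exact: measurable_swap|exact: swap_exceed].
have P1 : P [set w | field0 (Y w)] = 1%E.
  by rewrite -(probability_setT P); congr (P _); apply/seteqP; split=> // w _; exact: Y_field0.
rewrite -(es _ _ dom emap swap_bijective P1 _ mA); congr (P _).
apply/seteqP; split=> w /=; rewrite /exceedance_shift /A /=; case: swapP => //.
- by rewrite shiftK; split=> //; exact: Y_field0.
- move=> nDx Dx [_ Dxx]; by case: (Dshift Dxx); rewrite shiftNK.
- by move=> nDx nDx' [_]; rewrite shift0.
Qed.

End Swap.

(** A field that is not [k]-periodic has a rational strictly between two of its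
    values at distance [k], in one of the two orders; fixing the site, the rational
    and the order gives countably many sets disjoint from their translates, to
    which the involution applies.  On the periodic fields both sides of the
    balance are the same event. *)
Lemma exceedance_stationary_shift_balanced :
  exceedance_stationary Y -> shift_balanced.
Proof.
move=> es k D mD.
pose cross (p : lattice d * rat * bool) : set (field R d) :=
  let: (i, q, b) := p in
  if b then [set x | x i < ratr q] `&` [set x | ratr q < x (i + k)]
  else [set x | ratr q < x i] `&` [set x | x (i + k) < ratr q].
have mlt i (q : R) : measurable [set x : field R d | x i < q].
  have -> : [set x : field R d | x i < q] = (fun x => x i) @^-1` `]-oo, q[.
    by apply/seteqP; split=> x /=; rewrite in_itv.
  by apply: measurable_preimageT => //; exact: measurable_coord.
have mgt i (q : R) : measurable [set x : field R d | q < x i].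
  have -> : [set x : field R d | q < x i] = (fun x => x i) @^-1` `]q, +oo[.
    by apply/seteqP; split=> x /=; rewrite in_itv/= andbT.
  by apply: measurable_preimageT => //; exact: measurable_coord.
have mcross p : measurable (cross p).
  by case: p => [[i q] []]; apply: measurableI.
have cross_shift p x : cross p x -> ~ cross p (shift k x).
  case: p => [[i q] []] /= [x1 x2] [x3 x4].
    by have := lt_trans x2 x3; rewrite ltxx.
  by have := lt_trans x3 x2; rewrite ltxx.
pose F n := if unpickle n is Some p then cross p else set0.
have mF n : measurable (F n) by rewrite /F; case: unpickle.
have F_shift n x : F n x -> ~ F n (shift k x).
  by rewrite /F; case: unpickle => // p; exact: cross_shift.
have periodic x : ~ (\bigcup_n F n) x -> shift k x = x.
  move=> nF; apply/funext => i; apply/eqP; apply: contra_notT nF => neq.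
  have crossF (p : lattice d * rat * bool) : cross p x -> (\bigcup_n F n) x.
    by move=> cx; exists (pickle p) => //; rewrite /F pickleK.
  have [lt|lt|/eqP] := ltgtP (x i) (x (i + k)).
  - have [q] := rat_in_itvoo lt; rewrite in_itv/= => /andP[q1 q2].
    by apply: (crossF (i, q, true)).
  - have [q] := rat_in_itvoo lt; rewrite in_itv/= => /andP[q1 q2].
    by apply: (crossF (i, q, false)).
  - by rewrite eq_sym (negbTE neq).
pose G n := if n is Some m then seqDU F m else ~` \bigcup_n F n.
have mG n : measurable (G n).
  case: n => [n|] /=; last by apply: measurableC; exact: bigcup_measurable.
  by apply: measurableD => //; exact: bigsetU_measurable.
have tG : trivIset setT G.
  move=> [m|] [n|] _ _ [x [Gm Gn]] //.
  - by congr Some; apply: (trivIset_seqDU F) => //; exists x.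
  - by case: Gn; rewrite seqDU_bigcup_eq; exists m.
  - by case: Gm; rewrite seqDU_bigcup_eq; exists n.
have GT x : exists n, G n x.
  have [|nF] := pselect ((\bigcup_n F n) x); last by exists None.
  by rewrite seqDU_bigcup_eq => -[n _ ?]; exists (Some n).
(* the exceedance conditions make the involution an exceedance-map *)
pose E n := [set x | 1 < `|x 0| /\ 1 < `|x k|] `&` (D `&` G n) : set (field R d).
have mE n : measurable (E n).
  by apply: measurableI; [apply: measurableI; exact: measurable_exceed|exact: measurableI].
pose E1 n := [set w | E n (Y w)].
pose E2 n := [set w | E n (shift (- k) (Y w))].
have -> : [set w | 1 < `|Y w k| /\ D (Y w)] = \bigcup_n E1 n.
  apply/seteqP; split=> [w /= [wk Dw]|w [n _ [[_ wk] [Dw _]]]] //.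
  have [n Gn] := GT (Y w); exists n => //; split=> //; split=> //.
  exact: Y_field0.
have -> : [set w | 1 < `|Y w (- k)| /\ D (shift (- k) (Y w))] = \bigcup_n E2 n.
  apply/seteqP; split=> [w /= [wk Dw]|w [n _ [[wk _] [Dw _]]]] //; last first.
    by move: wk; rewrite shift_at0.
  have [n Gn] := GT (shift (- k) (Y w)); exists n => //; split=> //; split.
    by rewrite shift_at0.
  by rewrite shiftN_atN; exact: Y_field0.
apply: (@measure_bigcup_eq _ _ _ _ _ P P).
- by move=> n; exact: measurable_RV.
- by move=> n; apply: measurable_RV_preimage => //; exact: measurable_shift.
- by move=> m n _ _ [w [[_ [_ Gm]] [_ [_ Gn]]]]; apply: tG => //; exists (Y w).
- move=> m n _ _ [w [[_ [_ Gm]] [_ [_ Gn]]]]; apply: tG => //.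
  by exists (shift (- k) (Y w)).
case=> [n|].
  apply: exceedance_stationary_swap => //.
  - by move=> x [[]].
  - by move=> x [[]].
  - move=> x [_ [_ [Fx _]]] [_ [_ [Fx' _]]]; exact: (F_shift n x).
congr (P _); apply/seteqP; split=> w.
- move=> Ew; rewrite /E2 /= (_ : shift (- k) (Y w) = Y w)//.
  by case: Ew => _ [_ /periodic Yk]; rewrite -{1}Yk shiftK.
- move=> Ew; rewrite /E1 /= (_ : Y w = shift (- k) (Y w))//.
  by case: Ew => _ [_ /periodic]; rewrite shiftNK.
Qed.

End ShiftBalance.

(** * Continuous test functions on boxes *)

Section TestFunctions.
Local Open Scope classical_set_scope.
Local Open Scope ring_scope.
Context {R : realType} {d : nat}.
Implicit Types (s : seq (lattice d * (R -> R))) (x : field R d).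

(** Continuous, zero exactly on the nonpositive reals, and tending to the indicator of
    the positive ones when the argument is multiplied by [n -> oo]. *)
Definition clip (y : R) : R := Num.min 1 (Num.max 0 y).

Lemma clip_ge0 y : 0 <= clip y.
Proof. by rewrite /clip le_min ler01 le_max lexx. Qed.

Lemma clip_le1 y : clip y <= 1. Proof. by rewrite /clip ge_min lexx. Qed.

Lemma clip_le0 y : y <= 0 -> clip y = 0.
Proof. by move=> y0; rewrite /clip max_l// min_r. Qed.

Lemma clip_ge1 y : 1 <= y -> clip y = 1.
Proof. by move=> y1; rewrite /clip max_r ?min_l// (le_trans ler01). Qed.

Lemma continuous_clip : continuous clip.
Proof.
move=> y.
have -> : clip = (cst 1 : R -> R^o) \min ((cst 0 : R -> R^o) \max id) by [].
apply: continuous_min; first exact: cvg_cst.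
by apply: continuous_max; [exact: cvg_cst|exact: cvg_id].
Qed.

(** Continuous approximations of the indicator of [positivity_set s]. *)
Definition bump (n : nat) s x : R :=
  \prod_(p <- s) clip (n%:R * p.2 (x p.1)).

Definition positivity_set s : set (field R d) :=
  [set x | forall p, List.In p s -> 0 < p.2 (x p.1)].

Definition continuous_tests s := forall p, List.In p s -> continuous p.2.

Lemma bump_cons n p s x :
  bump n (p :: s) x = clip (n%:R * p.2 (x p.1)) * bump n s x.
Proof. by rewrite /bump big_cons. Qed.

Lemma bump_ge0 n s x : 0 <= bump n s x.
Proof. by apply: prodr_ge0 => p _; exact: clip_ge0. Qed.

Lemma bump_le1 n s x : bump n s x <= 1.
Proof.
elim: s => [|p s IH]; first by rewrite /bump big_nil.
by rewrite bump_cons mulr_ile1 ?clip_ge0 ?bump_ge0 ?clip_le1.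
Qed.

Lemma bump_eq0 n s x p : List.In p s -> p.2 (x p.1) <= 0 -> bump n s x = 0.
Proof.
move=> + p0; elim: s => // q s IH [->|/IH ps]; rewrite bump_cons ?ps ?mulr0//.
by rewrite clip_le0 ?mul0r// mulr_ge0_le0.
Qed.

Lemma positivity_set_nil : positivity_set [::] = setT.
Proof. by apply/seteqP; split=> // x _ p []. Qed.

Lemma positivity_set_cons p s :
  positivity_set (p :: s) = [set x | 0 < p.2 (x p.1)] `&` positivity_set s.
Proof.
apply/seteqP; split=> x.
  by move=> xs; split=> [|q qs]; apply: xs; [left|right].
by move=> [xp xs] q [<-//|/xs].
Qed.

Lemma positivity_set_cat s1 s2 :
  positivity_set (s1 ++ s2) = positivity_set s1 `&` positivity_set s2.
Proof.
elim: s1 => [|p s1 IH] /=; last by rewrite !positivity_set_cons IH setIA.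
by rewrite positivity_set_nil setTI.
Qed.

Lemma measurable_test (p : lattice d * (R -> R)) : continuous p.2 ->
  measurable_fun setT (fun x : field R d => p.2 (x p.1)).
Proof.
move=> cp; apply: (measurableT_comp _ (measurable_coord p.1)).
exact: continuous_measurable_fun.
Qed.

Lemma measurable_positivity_set s : continuous_tests s ->
  measurable (positivity_set s).
Proof.
elim: s => [|p s IH] cs.
  by rewrite positivity_set_nil.
rewrite positivity_set_cons; apply: measurableI; last first.
  by apply: IH => q qs; apply: cs; right.
rewrite (_ : [set x : field R d | _] = (fun x : field R d => p.2 (x p.1)) @^-1` `]0, +oo[).
  by apply: measurable_preimageT => //; apply: measurable_test; apply: cs; left.
by apply/seteqP; split=> x /=; rewrite in_itv/= andbT.
Qed.

Lemma measurable_bump n s : continuous_tests s -> measurable_fun setT (bump n s).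
Proof.
elim: s => [|p s IH] cs.
  by rewrite (_ : bump n [::] = cst 1)//; apply/funext => x; rewrite /bump big_nil.
rewrite (_ : bump n _ = (fun x => clip (n%:R * p.2 (x p.1))) \* bump n s); last first.
  by apply/funext => x; rewrite bump_cons.
apply: measurable_funM; last by apply: IH => q qs; apply: cs; right.
apply: (measurableT_comp (continuous_measurable_fun continuous_clip)).
by apply: measurable_funM => //; apply: measurable_test; apply: cs; left.
Qed.

Lemma bump_cvg s x : bump n s x @[n --> \oo] --> (\1_(positivity_set s) x : R).
Proof.
elim: s => [|p s IH].
  rewrite (_ : \1__ _ = 1); last first.
    by rewrite positivity_set_nil indicE mem_set.
  rewrite (_ : (fun n => _) = cst 1); first exact: cvg_cst.
  by apply/funext => n; rewrite /bump big_nil.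
rewrite positivity_set_cons indicI/=.
rewrite (_ : (fun n => _) = (fun n => clip (n%:R * p.2 (x p.1)) * bump n s x)); last first.
  by apply/funext => n; rewrite bump_cons.
apply: cvgM => //; rewrite indicE.
have [xp|xp] := ltP 0 (p.2 (x p.1)).
  rewrite mem_set//; apply: cvg_near_cst.
  near=> n; apply/clip_ge1; rewrite -ler_pdivrMr// div1r.
  by near: n; exact: nbhs_infty_ger.
rewrite memNset/=; last by apply/negP; rewrite -leNgt.
apply: cvg_near_cst; near=> n; apply: clip_le0.
by rewrite mulr_ge0_le0.
Unshelve. all: by end_near. Qed.

End TestFunctions.

Section TestFunctionsDetermine.
Local Open Scope classical_set_scope.
Local Open Scope ring_scope.
Context {R : realType} {d : nat}.
Implicit Types (s : seq (lattice d * (R -> R))) (x : field R d).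

(** The half-spaces [x k > a] already generate the product sigma-algebra, and the
    sets [positivity_set s] are closed under intersection. *)
Lemma eq_measure_positivity (m1 m2 : {measure set (field R d) -> \bar R}) :
  (m1 setT < +oo)%E ->
  (forall s, continuous_tests s -> m1 (positivity_set s) = m2 (positivity_set s)) ->
  forall A, measurable A -> m1 A = m2 A.
Proof.
move=> fin eqm A mA.
pose G : set (set (field R d)) :=
  [set A | exists2 s, continuous_tests s & A = positivity_set s].
apply: (measure_unique G (fun=> setT)) => //.
- apply/seteqP; split; last first.
    apply: smallest_sub; first exact: sigma_algebra_measurable.
    by move=> _ [s cs ->]; exact: measurable_positivity_set.
  apply: smallest_sub; first exact: smallest_sigma_algebra.
  move=> _ [k [B mB ->]].
  pose GT := g_sigma_algebraType G.
  have mk : measurable_fun setT (fun x : GT => x k : R).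
    apply: (@measurability _ _ GT R setT _ (@RGenOInfty.G R)).
      exact: RGenOInfty.measurableE.
    move=> _ [_ [a ->] <-]; rewrite setTI; apply: sub_sigma_algebra.
    exists [:: (k, fun r => r - a)].
      by move=> p [<-|//] y; apply: cvgB; [exact: cvg_id|exact: cvg_cst].
    rewrite positivity_set_cons positivity_set_nil setIT.
    by apply/seteqP; split=> x /=; rewrite in_itv/= andbT subr_gt0.
  by have := mk measurableT B mB; rewrite setTI.
- move=> _ _ [s1 cs1 ->] [s2 cs2 ->]; exists (s1 ++ s2).
    move=> p ps; have [/cs1//|/cs2//] : List.In p s1 \/ List.In p s2.
    exact: List.in_app_or.
  by rewrite positivity_set_cat.
- by move=> _; exists [::] => //; rewrite positivity_set_nil.
- by rewrite bigcup_const.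
- by move=> _ [s cs ->]; exact: eqm.
Qed.

Lemma lattice_bounded (k : lattice d) :
  exists m, forall m', (m <= m')%N -> [forall j, `|k 0 j| <= m'%:Z].
Proof.
exists (\max_(j < d) absz (k ord0 j))%N => m' mm'; apply/forallP => j.
by rewrite -abszE lez_nat (leq_trans _ mm')// (leq_bigmax (F := fun j => absz (k ord0 j)) j).
Qed.

(** The coordinate [k] of a field on a box, total in [k] so that one formula
    serves all the tests; it is only used for [k] inside the box. *)
Definition box_eval m (k : lattice d) (z : {ptws box m -> R}) : R :=
  if insub k is Some kb then z kb else 0.

Lemma continuous_box_eval m k : continuous (@box_eval m k).
Proof.
case E : (insub k : option (box m)) => [kb|].
  have -> : box_eval k = (fun z : {ptws box m -> R} => z kb).
    by apply/funext => z; rewrite /box_eval E.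
  exact: (@proj_continuous _ (fun _ : box m => R) kb).
have -> : box_eval k = (cst (0 : R) : {ptws box m -> R} -> R).
  by apply/funext => z; rewrite /box_eval E.
exact: cst_continuous.
Qed.

Lemma continuous_prod_clip (U : topologicalType) (e : lattice d -> U -> R) n s :
  continuous_tests s -> (forall k, continuous (e k)) ->
  continuous (fun z => \prod_(p <- s) clip (n%:R * p.2 (e p.1 z)) : R).
Proof.
move=> cs ce; elim: s cs => [|p s IH] cs.
  rewrite (_ : (fun z => _) = cst 1); first exact: cst_continuous.
  by apply/funext => z; rewrite big_nil.
rewrite (_ : (fun z => _) = (clip \o (fun z => n%:R * p.2 (e p.1 z))) \*
    (fun z => \prod_(p <- s) clip (n%:R * p.2 (e p.1 z)))); last first.
  by apply/funext => z; rewrite big_cons.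
move=> z; apply: continuousM; last by apply: IH => q qs; apply: cs; right.
apply: continuous_comp; last exact: continuous_clip.
apply: (@continuousM _ _ (cst n%:R) (p.2 \o e p.1)); first exact: cst_continuous.
apply: continuous_comp; first exact: ce.
by apply: cs; left.
Qed.

(** The bumps are test functions for the weak convergence in the definition of
    [tail_process], once the box contains all the sites involved. *)
Lemma bump_restrict_box n s : continuous_tests s ->
  exists m, exists f : {ptws box m -> R} -> R,
    [/\ continuous f, exists M : R, forall z, `|f z| <= M &
        forall x, f (@restrict_box R d m x) = bump n s x].
Proof.
move=> cs.
have [m sm] : exists m, forall p, List.In p s -> [forall j, `|p.1 0 j| <= m%:Z].
  elim: s {cs} => [|p s [m1 IH]]; first by exists 0%N.
  have [m2 pm] := lattice_bounded p.1; exists (maxn m1 m2) => q [<-|/IH qs].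
    by apply: pm; rewrite leq_maxr.
  apply/forallP => j; apply: le_trans (forallP qs j) _.
  by rewrite lez_nat leq_maxl.
pose f (z : {ptws box m -> R}) : R :=
  \prod_(p <- s) clip (n%:R * p.2 (box_eval p.1 z)).
exists m, f; split.
- by apply: continuous_prod_clip => // k; exact: continuous_box_eval.
- exists 1 => z; rewrite /f normr_prod.
  elim: s {cs sm f} => [|p s IH]; first by rewrite big_nil.
  rewrite big_cons mulr_ile1 ?prodr_ge0//.
  by rewrite ger0_norm ?clip_ge0// clip_le1.
- move=> x; rewrite /f /bump; elim: s sm {cs f} => [|p s IH] sm; first by rewrite !big_nil.
  rewrite !big_cons IH; last by move=> q qs; apply: sm; right.
  congr (clip (_ * p.2 _) * _); rewrite /box_eval.
  by rewrite insubT; first (by apply: sm; left).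
Qed.

End TestFunctionsDetermine.

(** * Limits of conditional laws *)

Section IntegralFacts.
Local Open Scope classical_set_scope.
Local Open Scope ring_scope.
Context {R : realType} {d : nat}.
Context {dT : measure_display} {T : measurableType dT}.

Lemma Rintegral_supported (mu : {measure set T -> \bar R}) (D : set T) (g : T -> R) :
  (forall w, ~ D w -> g w = 0) -> \int[mu]_(w in D) g w = \int[mu]_w g w.
Proof.
move=> gD; rewrite Rintegral_mkcond; congr (Rintegral _ _ _); apply/funext => w.
by rewrite patchE; case: ifPn => // /negP; rewrite inE => /gD.
Qed.

Lemma Rintegral_bump_cvg (P : probability T R) (f : T -> field R d)
    (s : seq (lattice d * (R -> R))) :
  measurable_fun setT f -> continuous_tests s ->
  \int[P]_w bump n s (f w) @[n --> \oo] -->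
    fine (P [set w | positivity_set s (f w)]).
Proof.
move=> mf cs.
have mS : measurable (f @^-1` positivity_set s).
  by apply: measurable_preimageT => //; exact: measurable_positivity_set.
have [] := @dominated_convergence _ _ _ P setT measurableT
  (fun n w => (bump n s (f w))%:E)
  (fun w => (\1_(f @^-1` positivity_set s) w)%:E) (cst 1%:E).
- move=> n; apply/measurable_EFinP.
  exact: (measurableT_comp (measurable_bump n cs) mf).
- by apply/measurable_EFinP; exact: measurable_indic.
- apply: aeW => w _; apply/fine_cvgP; split; first exact: nearW.
  have -> : \1_(f @^-1` positivity_set s) w = \1_(positivity_set s) (f w) :> R.
    by rewrite !indicE; congr (_%:R); apply/idP/idP; rewrite !inE.
  exact: bump_cvg.
- exact: finite_measure_integrable_cst.
- by apply: aeW => w n _; rewrite /= lee_fin ger0_norm ?bump_ge0 ?bump_le1.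
move=> _ _; rewrite integral_indic// setIT => cvgI.
apply: fine_cvg; rewrite fineK//; exact: fin_num_measure.
Qed.

Lemma eq_law_Rintegral (P : probability T R) (f1 f2 : T -> field R d) (g : field R d -> R) :
  measurable_fun setT f1 -> measurable_fun setT f2 ->
  measurable_fun setT g -> (forall x, 0 <= g x) ->
  (forall A, measurable A -> P (f1 @^-1` A) = P (f2 @^-1` A)) ->
  \int[P]_w g (f1 w) = \int[P]_w g (f2 w).
Proof.
move=> mf1 mf2 mg g0 eqP12; rewrite /Rintegral; congr fine.
have pf f (mf : measurable_fun setT f) :
    (\int[P]_w (g (f w))%:E = \int[law_on P mf measurableT]_x (g x)%:E)%E.
  transitivity (\int[pushforward P f]_x (g x)%:E)%E.
    rewrite ge0_integral_pushforward ?preimage_setT//.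
      exact/measurable_EFinP.
    by move=> x _; rewrite lee_fin.
  by congr (integral _ _ _); apply/funext => A; rewrite /= /law_on setIT.
rewrite (pf _ mf1) (pf _ mf2); apply: eq_measure_integral => A mA _.
by rewrite /= /law_on !setIT eqP12.
Qed.

End IntegralFacts.

Lemma real_cvg_unique (R : realType) (I : Type) (F : set_system I)
    {FF : ProperFilter F} (f : I -> R) (a b : R) :
  (f x @[x --> F] --> a)%classic -> (f x @[x --> F] --> b)%classic -> a = b.
Proof. by move=> fa fb; apply: (cvg_unique (@Rhausdorff R) fa fb). Qed.

Section BumpProbability.
Local Open Scope classical_set_scope.
Local Open Scope ring_scope.

(** The bumps tend to indicators, so equality of their means passes to the
    probabilities of the positivity sets. *)
Lemma eq_bump_probability (R : realType) (d : nat) d1 d2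
    (T1 : measurableType d1) (T2 : measurableType d2)
    (P1 : probability T1 R) (P2 : probability T2 R)
    (f1 : T1 -> field R d) (f2 : T2 -> field R d) (s : seq (lattice d * (R -> R))) :
  measurable_fun setT f1 -> measurable_fun setT f2 -> continuous_tests s ->
  (forall n, Rintegral P1 setT (fun w => bump n s (f1 w)) =
             Rintegral P2 setT (fun w => bump n s (f2 w))) ->
  P1 (f1 @^-1` positivity_set s)%classic = P2 (f2 @^-1` positivity_set s)%classic.
Proof.
move=> mf1 mf2 cs eqI; have mS := measurable_positivity_set cs.
have c1 := Rintegral_bump_cvg (P := P1) mf1 cs.
have c2 := Rintegral_bump_cvg (P := P2) mf2 cs.
rewrite -[LHS]fineK; last by apply: fin_num_measure; exact: measurable_preimageT.
rewrite -[RHS]fineK; last by apply: fin_num_measure; exact: measurable_preimageT.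
congr EFin.
have c2' : \int[P1]_w bump n s (f1 w) @[n --> \oo] -->
    fine (P2 (f2 @^-1` positivity_set s)).
  by under eq_fun do rewrite eqI.
exact: (real_cvg_unique c1 c2').
Qed.

End BumpProbability.

Section TailProcessLimits.
Local Open Scope classical_set_scope.
Local Open Scope ring_scope.
Context {R : realType} {d : nat}.
Context {dX : measure_display} {TX : measurableType dX} (PX : probability TX R).
Context (X : {RV PX >-> field R d}).
Implicit Types (s : seq (lattice d * (R -> R))).

Definition excess (u : R) : set TX := [set w | u < `|X w 0|].

Definition conditional_mean (g : field R d -> R) (u : R) : R :=
  (\int[PX]_(w in excess u) g (scale u^-1 (X w))) / fine (PX (excess u)).

Lemma tail_process_bump dY (TY : measurableType dY) (PY : probability TY R)
    (Y : {RV PY >-> field R d}) n s :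
  tail_process X Y -> continuous_tests s ->
  conditional_mean (bump n s) u @[u --> +oo] --> \int[PY]_w bump n s (Y w).
Proof.
move=> [_ _ tp] cs; have [m [f [cf bf fE]]] := bump_restrict_box n cs.
have -> : bump n s = fun x => f (@restrict_box R d m x).
  by apply/funext => x; rewrite fE.
exact: tp.
Qed.

Definition exceed_test (k : lattice d) : lattice d * (R -> R) :=
  (k, fun r => `|r| - 1).

Lemma continuous_exceed_test k : continuous (exceed_test k).2.
Proof. by move=> r; apply: cvgB; [exact: norm_continuous|exact: cvg_cst]. Qed.

(** A bump that tests for an exceedance at the origin vanishes outside the
    conditioning event, so its conditional mean is an unrestricted mean up to the
    normalization.  All the identities for [X] are exact because of this. *)
Lemma bump_no_excess n s u (x : field R d) : 0 < u ->
  List.In (exceed_test 0) s -> ~ u < `|x 0| -> bump n s (scale u^-1 x) = 0.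
Proof.
move=> u0 s0 /negP; rewrite -leNgt => xu; apply: (bump_eq0 _ s0).
by rewrite /= subr_le0 /scale normrM gtr0_norm ?invr_gt0// ler_pdivrMl// mulr1.
Qed.

Definition shift_tests (k : lattice d) s := [seq (p.1 + k, p.2) | p <- s].

Definition scale_tests (c : R) s : seq (lattice d * (R -> R)) :=
  [seq (p.1, fun r => p.2 (c * r)) | p <- s].

Lemma bump_shift n s k x : bump n s (shift k x) = bump n (shift_tests k s) x.
Proof. by rewrite /bump big_map. Qed.

Lemma bump_scale n s c x : bump n s (scale c x) = bump n (scale_tests c s) x.
Proof. by rewrite /bump big_map. Qed.

Lemma continuous_tests_shift k s : continuous_tests s -> continuous_tests (shift_tests k s).
Proof. by move=> cs p /List.in_map_iff[q [<- /cs]]. Qed.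

Lemma continuous_tests_scale c s : continuous_tests s -> continuous_tests (scale_tests c s).
Proof.
move=> cs p /List.in_map_iff[q [<- /cs cq]] r /=.
apply: (@continuous_comp _ _ _ (fun r => c * r) q.2); last exact: cq.
by apply: cvgM; [exact: cvg_cst|exact: cvg_id].
Qed.

Context {dT : measure_display} {T : measurableType dT} (P : probability T R).
Context (Y : {RV P >-> field R d}) (Y_field0 : forall w, field0 (Y w)).
Hypothesis tp : tail_process X Y.

Lemma tail_process_same_law dY (TY : measurableType dY) (PY : probability TY R)
    (Y' : {RV PY >-> field R d}) A :
  tail_process X Y' -> measurable A -> PY [set w | A (Y' w)] = P [set w | A (Y w)].
Proof.
move=> tp' mA.
suff eqA : law_on PY (measurable_funPT Y') measurableT A =
           law_on P (measurable_funPT Y) measurableT A.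
  by move: eqA; rewrite /= /law_on !setIT.
apply: eq_measure_positivity mA => [|s cs]; first exact: law_on_lty.
rewrite /= /law_on !setIT; apply: eq_bump_probability => // n.
exact: (real_cvg_unique (tail_process_bump tp' cs) (tail_process_bump tp cs)).
Qed.

End TailProcessLimits.

Section TailProcessNecessity.
Local Open Scope classical_set_scope.
Local Open Scope ring_scope.
Context {R : realType} {d : nat}.
Context {dX : measure_display} {TX : measurableType dX} (PX : probability TX R).
Context (X : {RV PX >-> field R d}).
Context {dT : measure_display} {T : measurableType dT} (P : probability T R).
Context (Y : {RV P >-> field R d}) (Y_field0 : forall w, field0 (Y w)).
Hypothesis tp : tail_process X Y.
Implicit Types (s : seq (lattice d * (R -> R))).

Lemma conditional_mean_supported n s u : 0 < u -> List.In (exceed_test 0) s ->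
  conditional_mean X (bump n s) u =
    (\int[PX]_w bump n s (scale u^-1 (X w))) / fine (PX (excess X u)).
Proof.
move=> u0 s0; congr (_ / _); apply: Rintegral_supported => w.
exact: bump_no_excess.
Qed.

Let mX : measurable_fun setT X := measurable_funPT X.
Let mY : measurable_fun setT Y := measurable_funPT Y.

(** With tests for exceedances at [0] and at [k], the shift by [- k] turns the
    bumps into bumps that still test the origin; stationarity of [X] then
    equates the two conditional means at every level, and both converge. *)
Lemma tail_process_shift_balanced : stationary X -> shift_balanced Y.
Proof.
move=> stat k D mD.
have mYk : measurable_fun setT (shift (- k) \o Y).
  by apply: measurableT_comp => //; exact: measurable_shift.
have mD1 : measurable [set w | 1 < `|Y w k|].
  exact: (measurable_RV Y (measurable_exceed 1 k)).
have mD2 : measurable [set w | 1 < `|Y w (- k)|].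
  exact: (measurable_RV Y (measurable_exceed 1 (- k))).
suff eqD : law_on P mY mD1 D = law_on P mYk mD2 D.
  by move: eqD; rewrite /= /law_on setIC => ->; rewrite setIC.
apply: eq_measure_positivity mD => [|s cs]; first exact: law_on_lty.
(* the test at the origin is vacuous for [Y], and so is the image of the test at
   [k] for the shifted field; they are needed for [X] *)
pose s' := exceed_test 0 :: exceed_test k :: s.
have cs' : continuous_tests s'.
  move=> p [<-|[<-|/cs//]]; exact: continuous_exceed_test.
have eqs' : P (Y @^-1` positivity_set s') = P ((shift (- k) \o Y) @^-1` positivity_set s').
  apply: eq_bump_probability => // n.
  under [RHS]eq_Rintegral do rewrite /= bump_shift.
  have c1 := tail_process_bump (n := n) tp cs'.
  have c2 := tail_process_bump (n := n) tp (continuous_tests_shift (k := - k) cs').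
  apply: (real_cvg_unique c1); apply: cvg_trans c2; apply: near_eq_cvg.
  near=> u; have u0 : 0 < u by near: u; exact: nbhs_pinfty_gt.
  rewrite !conditional_mean_supported//; last 2 first.
  - by left.
  - by right; left; rewrite /exceed_test/= subrr.
  congr (_ / _); under [LHS]eq_Rintegral do rewrite -bump_shift -scale_shift.
  apply/esym; apply: (eq_law_Rintegral (g := bump n s' \o scale u^-1)) => //.
  - by apply: measurableT_comp => //; exact: measurable_shift.
  - apply: measurableT_comp; first exact: measurable_bump.
    exact: measurable_scale.
  - by move=> x; exact: bump_ge0.
  - by move=> A mA; rewrite -(stat (- k) A mA).
move: eqs'; rewrite !positivity_set_cons /= /law_on => eqs'.
transitivity (P (Y @^-1` ([set x | 0 < `|x 0| - 1] `&`
    ([set x | 0 < `|x k| - 1] `&` positivity_set s)))).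
  congr (P _); apply/seteqP; split=> w /=; rewrite !subr_gt0.
    by move=> [? ?]; split=> //; exact: Y_field0.
  by tauto.
rewrite eqs'; congr (P _); apply/seteqP; split=> w /=; rewrite !subr_gt0.
  by rewrite shift_at0; tauto.
move=> [? ?]; rewrite shift_at0 shiftN_atN; split=> //; split=> //.
exact: Y_field0.
Unshelve. all: by end_near. Qed.

(** The unrestricted mean of a bump of [X / (u t)] can be normalized by the
    probability of an excess over [u] or over [u t].  Multiplying crosswise with
    the same two normalizations of a second bump removes the unknown ratio of the
    two probabilities, and the identity passes to the limit. *)
Lemma bump_cross_ratio n s t : 1 <= t -> continuous_tests s ->
  (\int[P]_w bump n (exceed_test 0 :: s) (scale t^-1 (Y w))) *
    (\int[P]_w bump n [:: exceed_test 0] (Y w)) =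
  (\int[P]_w bump n [:: exceed_test 0] (scale t^-1 (Y w))) *
    (\int[P]_w bump n (exceed_test 0 :: s) (Y w)).
Proof.
move=> t1 cs; have t0 : 0 < t by exact: lt_le_trans t1.
set s0 := exceed_test 0 :: s; set c0 := [:: exceed_test 0].
have cs0 : continuous_tests s0.
  by move=> p [<-|/cs//]; exact: continuous_exceed_test.
have cc0 : continuous_tests c0.
  by move=> p [<-|//]; exact: continuous_exceed_test.
have ut : u * t @[u --> +oo] --> +oo by apply: gt0_cvgMly => //; exact: cvg_id.
have near_level r : continuous_tests r ->
    conditional_mean X (bump n (scale_tests t^-1 r)) u @[u --> +oo] -->
      \int[P]_w bump n r (scale t^-1 (Y w)).
  move=> cr; under [X in _ --> X]eq_Rintegral do rewrite bump_scale.
  exact: (tail_process_bump tp (continuous_tests_scale (c := t^-1) cr)).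
have far_level r : continuous_tests r ->
    conditional_mean X (bump n r) (u * t) @[u --> +oo] --> \int[P]_w bump n r (Y w).
  move=> cr; exact: (cvg_comp _ _ ut (tail_process_bump tp cr)).
have unscale r u : 0 < u -> List.In (exceed_test 0) r ->
    conditional_mean X (bump n (scale_tests t^-1 r)) u =
    (\int[PX]_w bump n r (scale (u * t)^-1 (X w))) / fine (PX (excess X u)).
  move=> u0 r0; congr (_ / _).
  under [LHS]eq_Rintegral do rewrite -bump_scale.
  have scaleM x : scale t^-1 (scale u^-1 x) = scale (u * t)^-1 x :> field R d.
    by apply/funext => i; rewrite /scale mulrA -invfM (mulrC t).
  under [LHS]eq_Rintegral do rewrite scaleM.
  apply: Rintegral_supported => w wu; apply: bump_no_excess => //.
    by rewrite mulr_gt0.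
  by move=> uw; apply: wu; apply: le_lt_trans uw; rewrite ler_peMr //; exact: ltW.
have c1 : conditional_mean X (bump n (scale_tests t^-1 s0)) u *
    conditional_mean X (bump n c0) (u * t) @[u --> +oo] -->
    (\int[P]_w bump n s0 (scale t^-1 (Y w))) * (\int[P]_w bump n c0 (Y w)).
  by apply: cvgM; [exact: near_level|exact: far_level].
have c2 : conditional_mean X (bump n (scale_tests t^-1 c0)) u *
    conditional_mean X (bump n s0) (u * t) @[u --> +oo] -->
    (\int[P]_w bump n c0 (scale t^-1 (Y w))) * (\int[P]_w bump n s0 (Y w)).
  by apply: cvgM; [exact: near_level|exact: far_level].
apply: (real_cvg_unique c1); apply: cvg_trans c2; apply: near_eq_cvg.
near=> u; have u0 : 0 < u by near: u; exact: nbhs_pinfty_gt.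
rewrite !unscale//; [|by left..].
rewrite !conditional_mean_supported ?mulr_gt0//; [|by left..].
by rewrite mulrACA [RHS]mulrACA; congr (_ * _); rewrite mulrC.
Unshelve. all: by end_near. Qed.

(** In the limit of the crosswise identity, the second bump becomes the indicator
    of an exceedance at the origin, which [Y] has surely. *)
Lemma tail_process_tail_homogeneous alpha :
  pareto P alpha (fun w => `|Y w 0|) -> tail_homogeneous Y alpha.
Proof.
move=> par t C t1 mC; have t0 : 0 < t by exact: lt_le_trans t1.
pose c := NngNum (powR_ge0 t (- alpha)).
have mYt : measurable_fun setT (scale t^-1 \o Y).
  by apply: measurableT_comp => //; exact: measurable_scale.
have mD : measurable [set w | t < `|Y w 0|].
  exact: (measurable_RV Y (measurable_exceed t 0)).
suff eqC : law_on P mYt mD C = mscale c (law_on P mY measurableT) C.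
  by move: eqC; rewrite /= /mscale/= /law_on setIT setIC.
apply: eq_measure_positivity mC => [|s cs]; first exact: law_on_lty.
rewrite /= /mscale/= /law_on setIT.
have cc0 : continuous_tests [:: @exceed_test R d 0].
  by move=> p [<-|//]; exact: continuous_exceed_test.
have cs0 : continuous_tests (exceed_test 0 :: s).
  by move=> p [<-|/cs//]; exact: continuous_exceed_test.
have cross n := @bump_cross_ratio n s t t1 cs.
pose p r (f : T -> field R d) := fine (P (f @^-1` positivity_set r)).
have L1 : (\int[P]_w bump n (exceed_test 0 :: s) (scale t^-1 (Y w))) *
    (\int[P]_w bump n [:: exceed_test 0] (Y w)) @[n --> \oo] -->
    p (exceed_test 0 :: s) (scale t^-1 \o Y) * p [:: exceed_test 0] Y.
  by apply: cvgM; apply: Rintegral_bump_cvg.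
have L2 : (\int[P]_w bump n [:: exceed_test 0] (scale t^-1 (Y w))) *
    (\int[P]_w bump n (exceed_test 0 :: s) (Y w)) @[n --> \oo] -->
    p [:: exceed_test 0] (scale t^-1 \o Y) * p (exceed_test 0 :: s) Y.
  by apply: cvgM; apply: Rintegral_bump_cvg.
move: L1; under eq_fun do rewrite cross.
move=> /real_cvg_unique /(_ L2) {cross L2}; rewrite /p.
have scaled w : (0 < `|scale t^-1 (Y w) 0| - 1) = (t < `|Y w 0|).
  rewrite subr_gt0 /scale normrM gtr0_norm ?invr_gt0//.
  by rewrite ltr_pdivlMl// mulr1.
rewrite !positivity_set_cons positivity_set_nil /=.
have -> : Y @^-1` ([set x | 0 < `|x 0| - 1] `&` setT) = setT.
  apply/seteqP; split=> // w _ /=; split=> //.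
  by rewrite subr_gt0; exact: Y_field0.
have -> : Y @^-1` ([set x | 0 < `|x 0| - 1] `&` positivity_set s) = Y @^-1` positivity_set s.
  apply/seteqP; split=> w /=; first by case.
  by move=> ws; split=> //; rewrite subr_gt0; exact: Y_field0.
have -> : (scale t^-1 \o Y) @^-1` ([set x | 0 < `|x 0| - 1] `&` setT) = [set w | t < `|Y w 0|].
  by apply/seteqP; split=> w /=; rewrite scaled; tauto.
rewrite (par t t1) probability_setT /= mulr1 => eqr.
rewrite -[RHS]fineK; last first.
  rewrite fin_numM// fin_num_measure//.
  by apply: measurable_RV; exact: measurable_positivity_set.
rewrite -[LHS]fineK; last first.
  rewrite fin_num_measure//; apply: measurableI => //.
  by apply: measurable_preimageT => //; exact: measurable_positivity_set.
congr EFin; rewrite fineM//; last first.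
  by rewrite fin_num_measure//; apply: measurable_RV; exact: measurable_positivity_set.
rewrite -eqr; congr (fine (P _)).
by apply/seteqP; split=> w /=; rewrite scaled; tauto.
Qed.

End TailProcessNecessity.

(** * Weak convergence from one-sided bounds *)

Section CylinderMeasurability.
Local Open Scope classical_set_scope.
Local Open Scope ring_scope.
Context {R : realType} {d : nat}.

(** The preimage is a union of fibres of the code, of which there are countably
    many, whatever [Z] is. *)
Lemma measurable_factor_countable dT (T : measurableType dT) (C : countType)
    (S : Type) (code : T -> C) (h : T -> S) (Z : set S) :
  (forall c, measurable [set x | code x = c]) ->
  (forall x x', code x = code x' -> h x = h x') -> measurable (h @^-1` Z).
Proof.
move=> mcode hcode.
pose F n := if unpickle n is Some c then
  [set x | code x = c /\ exists2 x', code x' = c & Z (h x')] else set0.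
have -> : h @^-1` Z = \bigcup_n F n.
  apply/seteqP; split=> [x Zx|x [n _]].
    by exists (pickle (code x)) => //; rewrite /F pickleK; split=> //; exists x.
  by rewrite /F; case: unpickle => // c [xc [x' x'c]]; rewrite /preimage/= (hcode x x')// xc.
apply: bigcup_measurable => n _; rewrite /F; case: unpickle => // c.
have [cZ|cZ] := pselect (exists2 x', code x' = c & Z (h x')).
  rewrite (_ : [set x | _] = [set x | code x = c])//.
  by apply/seteqP; split=> x //= [].
by rewrite (_ : [set x | _] = set0)//; apply/seteqP; split=> x //= [].
Qed.

Lemma measurable_floor_code (a : R) (ks : seq (lattice d)) (c : seq int) :
  measurable [set x : field R d | [seq Num.floor (a * x k) | k <- ks] = c].
Proof.
elim: ks c => [|k ks IH] [|z c] /=.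
- by rewrite (_ : [set _ | _] = setT)//; apply/seteqP; split.
- by rewrite (_ : [set _ | _] = set0)//; apply/seteqP; split.
- by rewrite (_ : [set _ | _] = set0)//; apply/seteqP; split.
rewrite (_ : [set _ | _] = (fun x : field R d => a * x k) @^-1` `[z%:~R, (z + 1)%:~R[ `&`
    [set x | [seq Num.floor (a * x k) | k <- ks] = c]).
  apply: measurableI => //; apply: measurable_preimageT => //.
  by apply: measurable_funM => //; exact: measurable_coord.
apply/seteqP; split=> x /=; rewrite in_itv/=.
  by move=> [<- <-]; rewrite floor_itv.
by move=> [/floor_def -> ->].
Qed.

(** Only the first [n] sites are kept, so that [round_field n x] is a function of
    finitely many integers while still converging pointwise to [x]. *)
Definition round_field (n : nat) (x : field R d) : field R d := fun k =>
  if (pickle k < n)%N then (Num.floor (n.+1%:R * x k))%:~R / n.+1%:R else 0.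

Lemma round_field_cvg (x : field R d) k : round_field n x k @[n --> \oo] --> x k.
Proof.
apply/cvgrPdist_le => e e0; near=> n.
have n0 : (0 : R) < n.+1%:R by rewrite ltr0n.
rewrite /round_field ifT; last by near: n; exact: nbhs_infty_gt.
have /andP[fl1 fl2] := floor_itv (n.+1%:R * x k).
rewrite intrD in fl2; set z := _%:~R in fl1 fl2 *.
have -> : x k - z / n.+1%:R = (n.+1%:R * x k - z) / n.+1%:R.
  by rewrite mulrBl mulrAC divff ?mul1r// gt_eqF.
rewrite normrM normfV (gtr0_norm n0) ger0_norm ?subr_ge0//.
rewrite ler_pdivrMr// (le_trans (y := 1))//.
  by rewrite lerBlDl ltW.
rewrite -ler_pdivrMl// mulr1; near: n.
have : n%:R @[n --> \oo] --> (+oo : set_system R) by exact: cvgr_idn.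
move=> /cvgryPge /(_ e^-1); apply: filterS => n /le_trans; apply.
by rewrite ler_nat.
Unshelve. all: by end_near. Qed.

(** The index set is a bare type here, whence the detour through the supremum
    topology. *)
Lemma ptws_cvg (I : Type) (F : set_system (I -> R)) (f : I -> R) : Filter F ->
  (forall i, g i @[g --> F] --> f i) -> F --> (f : {ptws I -> R}).
Proof.
move=> FF pf; apply/cvg_sup => i; rewrite cvg_image; last first.
  by rewrite eqEsubset; split=> v // _; exists (cst v).
move=> W /= /(pf i) FW; exists (@^~ i @^-1` W) => //.
by rewrite eqEsubset; split=> [j [g gW <-//]|j Wj]; exists (fun=> j).
Qed.

(** A continuous function is the pointwise limit of its values at the rounded
    fields, which are determined by a code in [seq int]. *)
Lemma measurable_restrict_box m (f : {ptws box m -> R} -> R) : continuous f ->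
  measurable_fun setT (fun x : field R d => f (@restrict_box R d m x)).
Proof.
move=> cf; apply: (measurable_fun_cvg
  (h := fun n x => f (@restrict_box R d m (round_field n x)))).
  move=> n _ Z mZ; rewrite setTI.
  pose ks : seq (lattice d) := pmap unpickle (iota 0 n).
  apply: (@measurable_factor_countable _ _ _ _
    (fun x : field R d => [seq Num.floor (n.+1%:R * x k) | k <- ks])).
    by move=> c; exact: measurable_floor_code.
  move=> x x' eqxx'; congr f; apply/funext => kb; rewrite /restrict_box /round_field.
  case: ifPn => // kn; congr (_%:~R / _).
  have : val kb \in ks.
    by rewrite mem_pmap; apply/mapP; exists (pickle (val kb)); rewrite ?mem_iota ?pickleK.
  by move: (val kb); apply/eq_in_map.
move=> x _.
apply: (continuous_cvg _ (cf (@restrict_box R d m x))).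
by apply: ptws_cvg => kb W; exact: (@round_field_cvg x (val kb) W).
Qed.

End CylinderMeasurability.

Section Minorization.
Local Open Scope classical_set_scope.
Local Open Scope ring_scope.
Context {R : realType}.
Context d0 (S : measurableType d0).
Context d1 (T1 : measurableType d1) (P1 : probability T1 R).
Context d2 (T2 : measurableType d2) (P2 : probability T2 R).

Lemma ge0_integral_law_on (f : T1 -> S) (D : set T1) (mf : measurable_fun setT f)
    (mD : measurable D) (g : S -> R) :
  measurable_fun setT g -> (forall x, 0 <= g x) ->
  (\int[law_on P1 mf mD]_x (g x)%:E = \int[P1]_(w in D) (g (f w))%:E)%E.
Proof.
move=> mg g0.
have mgf : measurable_fun setT (g \o f) by exact: measurableT_comp.
transitivity (\int[pushforward (mrestr P1 mD) f]_x (g x)%:E)%E; first by [].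
rewrite ge0_integral_pushforward//; last 2 first.
- exact/measurable_EFinP.
- by move=> x _; rewrite lee_fin.
rewrite preimage_setT (@ge0_negligible_integral _ _ _ _ _ (~` D)) ?setTD ?setCK//.
- by apply: eq_measure_integral => A mA AD; rewrite /= /mrestr setIidl.
- exact: measurableC.
- exact/measurable_EFinP.
- by move=> w _; rewrite lee_fin.
- by rewrite /= /mrestr setICl measure0.
Qed.

(** A law that dominates [a] times a probability exceeds it only by a measure of
    mass [P1 D - a], which bounds the difference of the integrals.  Domination is
    used on the two nonnegative functions [M + g] and [M - g]. *)
Lemma minorization_Rintegral (f1 : T1 -> S) (f2 : T2 -> S) (D : set T1) (a M : R)
    (g : S -> R) :
  measurable_fun setT f1 -> measurable_fun setT f2 -> measurable D -> 0 <= a ->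
  measurable_fun setT g -> (forall x, `|g x| <= M) ->
  (forall A, measurable A -> (a%:E * P2 (f2 @^-1` A) <= P1 (f1 @^-1` A `&` D))%E) ->
  `|\int[P1]_(w in D) g (f1 w) - a * \int[P2]_w g (f2 w)| <= M * (fine (P1 D) - a).
Proof.
move=> mf1 mf2 mD a0 mg gM minor.
have int d (T : measurableType d) (P : probability T R) E (h : T -> R) (K : R) : measurable E ->
    measurable_fun setT h -> (forall w, `|h w| <= K) -> P.-integrable E (EFin \o h).
  move=> mE mh hK; apply: measurable_bounded_integrable => //.
  - exact: le_lt_trans (probability_le1 P mE) (ltry 1).
  - exact: measurable_funTS.
  exists K; split=> [|y My w _]; first exact: num_real.
  by rewrite /= (le_trans (hK w))// ltW.
have minor_ge0 (h : S -> R) (K : R) : measurable_fun setT h -> (forall x, 0 <= h x <= K) ->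
    a * \int[P2]_w h (f2 w) <= \int[P1]_(w in D) h (f1 w).
  move=> mh hK; have h0 x : 0 <= h x by have /andP[] := hK x.
  have hK' x : `|h x| <= K by have /andP[_] := hK x; rewrite ger0_norm.
  have i1 := int _ _ P1 D _ K mD (measurableT_comp mh mf1) (fun w => hK' (f1 w)).
  have i2 := int _ _ P2 setT _ K measurableT (measurableT_comp mh mf2) (fun w => hK' (f2 w)).
  rewrite -lee_fin EFinM /Rintegral !fineK; try exact: integrable_fin_num.
  have -> : (\int[P2]_w (h (f2 w))%:E = \int[pushforward P2 f2]_x (h x)%:E)%E.
    rewrite ge0_integral_pushforward//; first exact/measurable_EFinP.
    by move=> x _; rewrite lee_fin.
  have -> : (\int[pushforward P2 f2]_x (h x)%:E = \int[law_on P2 mf2 measurableT]_x (h x)%:E)%E.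
    by congr (integral _ _ _); apply/funext => A; rewrite /= /law_on setIT.
  rewrite -(ge0_integral_law_on mf1 mD mh h0).
  pose c := NngNum a0.
  rewrite -(ge0_integral_mscale (law_on P2 mf2 measurableT) measurableT c); last 2 first.
  - exact/measurable_EFinP.
  - by move=> x _; rewrite lee_fin.
  apply: ge0_le_measure_integral => //.
  - by move=> A mA; rewrite /= /mscale/= /law_on setIT; exact: minor.
  - exact/measurable_EFinP.
have i1 := int _ _ P1 D _ M mD (measurableT_comp mg mf1) (fun w => gM (f1 w)).
have i2 := int _ _ P2 setT _ M measurableT (measurableT_comp mg mf2) (fun w => gM (f2 w)).
have c1 := int _ _ P1 D (cst M) `|M| mD (measurable_cst M) (fun=> lexx _).
have c2 := int _ _ P2 setT (cst M) `|M| measurableT (measurable_cst M) (fun=> lexx _).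
have PT : fine (P2 setT) = 1 by rewrite probability_setT.
have e1 : \int[P1]_(w in D) (M + g (f1 w)) = M * fine (P1 D) + \int[P1]_(w in D) g (f1 w).
  by rewrite RintegralD// Rintegral_cst.
have e2 : \int[P2]_w (M + g (f2 w)) = M + \int[P2]_w g (f2 w).
  by rewrite RintegralD// Rintegral_cst// PT mulr1.
have e3 : \int[P1]_(w in D) (M - g (f1 w)) = M * fine (P1 D) - \int[P1]_(w in D) g (f1 w).
  by rewrite RintegralB// Rintegral_cst.
have e4 : \int[P2]_w (M - g (f2 w)) = M - \int[P2]_w g (f2 w).
  by rewrite RintegralB// Rintegral_cst// PT mulr1.
have p1 : a * \int[P2]_w (M + g (f2 w)) <= \int[P1]_(w in D) (M + g (f1 w)).
  apply: (minor_ge0 (fun x => M + g x) (M + M)); first exact: measurable_funD.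
  by move=> x; have := gM x; rewrite ler_norml => /andP[]; lra.
have p2 : a * \int[P2]_w (M - g (f2 w)) <= \int[P1]_(w in D) (M - g (f1 w)).
  apply: (minor_ge0 (fun x => M - g x) (M + M)); first exact: measurable_funB.
  by move=> x; have := gM x; rewrite ler_norml => /andP[]; lra.
move: p1 p2; rewrite e1 e2 e3 e4 ler_norml; move: (fine _) (Rintegral _ _ _) (Rintegral _ _ _).
by move=> p x y p1 p2; apply/andP; split; lra.
Qed.

End Minorization.

Section TailLimit.
Local Open Scope classical_set_scope.
Local Open Scope ring_scope.
Context {R : realType} {d : nat}.
Context {dX : measure_display} {TX : measurableType dX} (PX : probability TX R).
Context (X : {RV PX >-> field R d}).
Context {dT : measure_display} {T : measurableType dT} (P : probability T R).
Context (Y : {RV P >-> field R d}).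

Definition in_box (m : nat) (i : lattice d) : bool := [forall j, `|i 0 j| <= m%:Z].

Definition box_local (m : nat) (C : set (field R d)) : Prop :=
  forall x y, (forall i, in_box m i -> x i = y i) -> C x -> C y.

Definition truncate_box (m : nat) (x : field R d) : field R d :=
  fun i => if in_box m i then x i else 0.

Lemma measurable_truncate_box m : measurable_fun setT (truncate_box m).
Proof.
apply: measurable_fun_field => i; rewrite /truncate_box.
by case: (in_box m i) => //; exact: measurable_coord.
Qed.

(** For the weak convergence of the conditional laws it is enough to bound them
    from below, on the events of a box, by the limit law times factors that tend
    to 1: the remaining mass tends to 0 and can be anything. *)
Lemma tail_limit_of_minorization (m : nat) (r : R -> R)
    (f : {ptws box m -> R} -> R) :
  (forall u : R, (0 < PX (excess X u))%E) ->
  r u @[u --> +oo] --> (1 : R) ->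
  (\forall u \near +oo, 0 <= r u /\
     forall C, measurable C -> box_local m C ->
       ((r u)%:E * PX (excess X u) * P [set w | C (Y w)] <=
        PX ([set w | C (scale u^-1 (X w))] `&` excess X u))%E) ->
  continuous f -> (exists M : R, forall x, `|f x| <= M) ->
  (\int[PX]_(w in excess X u) f (@restrict_box R d m (scale u^-1 (X w))))
    / fine (PX (excess X u)) @[u --> +oo] -->
  \int[P]_w f (@restrict_box R d m (Y w)).
Proof.
move=> pos r1 minor cf [M fM].
pose g (x : field R d) := f (@restrict_box R d m x).
have mg : measurable_fun setT g by exact: measurable_restrict_box.
have gt x : g (truncate_box m x) = g x.
  rewrite /g; congr f; apply/funext => kb; rewrite /restrict_box /truncate_box.
  by rewrite ifT//; exact: (valP kb).
pose L := \int[P]_w g (Y w).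
have mexc u : measurable (excess X u).
  exact: (measurable_RV X (measurable_exceed u 0)).
have excfin u : PX (excess X u) \is a fin_num by exact: fin_num_measure.
pose q u := (\int[PX]_(w in excess X u) g (scale u^-1 (X w))) / fine (PX (excess X u)).
have bound : \forall u \near +oo, `|q u - r u * L| <= M * (1 - r u).
  near=> u.
  have [r0 minoru] : 0 <= r u /\ forall C, measurable C -> box_local m C ->
       ((r u)%:E * PX (excess X u) * P [set w | C (Y w)] <=
        PX ([set w | C (scale u^-1 (X w))] `&` excess X u))%E by near: u.
  pose p := fine (PX (excess X u)).
  have p0 : 0 < p by rewrite fine_gt0// pos ltey_eq excfin.
  have mf1 : measurable_fun setT (truncate_box m \o (scale u^-1 \o X)).
    apply: measurableT_comp; first exact: measurable_truncate_box.
    by apply: measurableT_comp => //; exact: measurable_scale.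
  have mf2 : measurable_fun setT (truncate_box m \o Y).
    by apply: measurableT_comp => //; exact: measurable_truncate_box.
  have := @minorization_Rintegral R _ _ _ _ PX _ _ P _ _ _ (r u * p) M g mf1 mf2 (mexc u).
  move=> /(_ (mulr_ge0 r0 (ltW p0)) mg (fun x => fM _)).
  have dom A : measurable A ->
    ((r u * p)%:E * P ((truncate_box m \o Y) @^-1` A) <=
     PX ((truncate_box m \o (scale u^-1 \o X)) @^-1` A `&` excess X u))%E.
    move=> mA; have := minoru (truncate_box m @^-1` A).
    rewrite EFinM /p fineK//; apply.
      by apply: measurable_preimageT => //; exact: measurable_truncate_box.
    move=> x y xy; rewrite /preimage/= (_ : truncate_box m x = truncate_box m y)//.
    by apply/funext => i; rewrite /truncate_box; case: ifP => // /xy.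
  move=> /(_ dom).
  under eq_Rintegral do rewrite /= gt.
  under [X in _ * X]eq_Rintegral do rewrite /= gt.
  rewrite -/L -/p => H.
  have -> : q u - r u * L = (\int[PX]_(w in excess X u) g (scale u^-1 (X w)) - r u * p * L) / p.
    by rewrite /q -/p; move: (Rintegral _ _ _) => I; field; exact: lt0r_neq0.
  rewrite normrM normfV (gtr0_norm p0) ler_pdivrMr// (le_trans H)//.
  by rewrite -mulrA mulrBl mul1r.
have diff0 : q u - r u * L @[u --> +oo] --> 0.
  apply/norm_cvg0P.
  apply: (@squeeze_cvgr _ _ _ _ (cst 0) (fun u => M * (1 - r u))).
  - by near=> u; rewrite /cst normr_ge0/=; near: u.
  - exact: cvg_cst.
  - suff : M * (1 - r u) @[u --> +oo] --> M * (1 - 1) by rewrite subrr mulr0.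
    by apply: cvgM; [exact: cvg_cst|apply: cvgB => //; exact: cvg_cst].
have rL : r u * L @[u --> +oo] --> L.
  by rewrite -[X in _ --> X]mul1r; apply: cvgM => //; exact: cvg_cst.
have : (q u - r u * L) + r u * L @[u --> +oo] --> 0 + L by apply: cvgD.
rewrite add0r.
by apply: cvg_trans; apply: near_eq_cvg; near=> u; rewrite /= subrK.
Unshelve. all: by end_near. Qed.

End TailLimit.

(** * Periodization over a finite torus *)

Section Torus.
Local Open Scope ring_scope.
Context (d N : nat).

Local Notation torus := 'rV['I_N.+2]_d.

(** The torus is [Z / (N + 2)] in each of the [d] directions; the modulus is at
    least 2 for ['I_N.+2] to be a ring, so that reduction is a ring morphism. *)
Definition proj (k : lattice d) : torus := map_mx (fun z : int => z%:~R) k.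

Definition rep (l : torus) : lattice d := map_mx (fun i : 'I_N.+2 => (i : nat)%:Z) l.

Lemma projD k1 k2 : proj (k1 + k2) = proj k1 + proj k2.
Proof. by apply/rowP => j; rewrite !mxE intrD. Qed.

Lemma proj0 : proj 0 = 0.
Proof. by apply/rowP => j; rewrite !mxE. Qed.

Lemma repK : cancel rep proj.
Proof. by move=> l; apply/rowP => j; rewrite !mxE -pmulrn natr_Zp. Qed.

Lemma projK (k : lattice d) : (forall j, 0 <= k 0 j < N.+2%:Z) -> rep (proj k) = k.
Proof.
move=> k0; apply/rowP => j; rewrite !mxE; have := k0 j.
case: (k 0 j) => // n /andP[_ nN]; rewrite -pmulrn; congr Posz.
by rewrite -[RHS](@modn_small n N.+2) //; exact: (@val_Zp_nat N.+2).
Qed.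

(** The classes whose representative stays in the fundamental domain under any
    translation from the box of radius [m]. *)
Definition interior (m : nat) : {set torus} :=
  [set l : torus | [forall j, (m <= l 0%R j) && (l 0%R j + m < N.+2)]]%N.

Lemma rep_interior m l i : l \in interior m -> in_box m i ->
  rep (l + proj i) = rep l + i.
Proof.
rewrite inE => /forallP lm /forallP im.
rewrite -{1}(repK l) -projD projK// => j; rewrite !mxE.
have /andP[l1 l2] := lm j; have := im j; rewrite ler_norml => /andP[i1 i2].
move: (nat_of_ord (l 0 j)) (i 0 j) l1 l2 i1 i2 => n z; lia.
Qed.

(** A cube of side [N + 2 - 2 m], moved by [m], is interior. *)
Lemma card_interior m : ((N.+2 - m.*2) ^ d <= #|interior m|)%N.
Proof.
pose emb (l : 'rV['I_(N.+2 - m.*2)]_d) : torus :=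
  map_mx (fun i : 'I_(N.+2 - m.*2) => inord (i + m)) l.
have embE (l : 'rV['I_(N.+2 - m.*2)]_d) j : emb l 0 j = (l 0%R j + m)%N :> nat.
  by rewrite mxE inordK//; have := ltn_ord (l 0%R j); lia.
have emb_inj : injective emb.
  move=> l1 l2 l12; apply/rowP => j; apply/val_inj/eqP.
  by rewrite /= -(eqn_add2r m) -!embE l12.
have <- : #|[set emb l | l in [set: 'rV['I_(N.+2 - m.*2)]_d]]| = ((N.+2 - m.*2) ^ d)%N.
  by rewrite card_imset// cardsT card_mx card_ord mul1n.
apply: subset_leq_card; apply/fintype.subsetP => _ /imsetP[l _ ->].
rewrite inE; apply/forallP => j; rewrite embE.
have := ltn_ord (l 0%R j); move: (nat_of_ord _) => n; lia.
Qed.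

End Torus.

Section FiniteSumOfMeasures.
Local Open Scope classical_set_scope.
Local Open Scope ring_scope.
Context d (T : measurableType d) (R : realType) (I : finType).
Variable m : I -> {measure set T -> \bar R}.

Definition fin_msum (A : set T) : \bar R := (\sum_(i : I) m i A)%E.

Let enum_measure (n : nat) : {measure set T -> \bar R} :=
  if (insub n : option 'I_#|I|) is Some i then m (enum_val i) else mzero.

Let fin_msumE : fin_msum = msum enum_measure #|I|.
Proof.
apply/funext => A; rewrite /fin_msum /msum big_enum_val/=.
by apply: eq_bigr => i _; rewrite /enum_measure valK.
Qed.

Let fin_msum0 : fin_msum set0 = 0%E.
Proof. by rewrite fin_msumE measure0. Qed.

Let fin_msum_ge0 A : (0 <= fin_msum A)%E.
Proof. by rewrite fin_msumE. Qed.

Let fin_msum_sigma_additive : semi_sigma_additive fin_msum.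
Proof. by rewrite fin_msumE; exact: measure_semi_sigma_additive. Qed.

HB.instance Definition _ := isMeasure.Build _ _ _ fin_msum
  fin_msum0 fin_msum_ge0 fin_msum_sigma_additive.

End FiniteSumOfMeasures.

Lemma measure_bigcup_finType d (R : realType) (T : measurableType d)
    (mu : {measure set T -> \bar R}%R) (I : finType) (F : I -> set T) :
  (forall i, measurable (F i)) -> trivIset setT F ->
  mu (\bigcup_i F i)%classic = (\sum_(i : I) mu (F i))%E.
Proof.
move=> mF tF; have -> : [set: I]%classic = [set` enum I]%classic.
  by apply/seteqP; split=> i _ //=; rewrite mem_enum.
rewrite measure_fin_bigcup//; last exact: sub_trivIset tF.
by rewrite -fsbig_seq ?enum_uniq// big_enum.
Qed.

Section TorusLaw.
Local Open Scope classical_set_scope.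
Local Open Scope ring_scope.
Context {R : realType} {d : nat} {dT : measure_display} {T : measurableType dT}.
Context (P : probability T R) (Y : {RV P >-> field R d}) (N : nat).

Local Notation torus := 'rV['I_N.+2]_d.
Implicit Types (l k : torus) (x y : field R d).

(** The restriction of [y] to the translate by [- rep k] of the fundamental domain,
    repeated periodically, and seen from [l]; the origin of [y] sits at the
    class [k]. *)
Definition torus_field l k y : field R d := fun i => y (rep (l + proj N i) - rep k).

(** The fields for which the origin is, among the exceedance points in the
    translate by [- rep k] of the fundamental domain, the first one. *)
Definition first_exceedance k : set (field R d) :=
  \bigcap_(j in [set j : torus | (enum_rank j < enum_rank k)%N])
    ~` [set y | 1 < `|y (rep j - rep k)|].

Lemma measurable_torus_field l k : measurable_fun setT (torus_field l k).
Proof. by apply: measurable_fun_field => i; exact: measurable_coord. Qed.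

Lemma measurable_first_exceedance k : measurable (first_exceedance k).
Proof.
apply: fin_bigcap_measurable => [|j _]; first exact: finite_finset.
by apply: measurableC; exact: measurable_exceed.
Qed.

Hypothesis Y_field0 : forall w, field0 (Y w).
Hypothesis bal : shift_balanced Y.

(** Balance moves the term [k] from the origin at [k] to the origin at [l].  There
    the events that the first exceedance of the fundamental domain is at [k] are
    disjoint, and they cover everything because [l] itself is an exceedance.  So
    the origins [k] together produce exactly one copy of the law of [Y], seen from
    any class [l]. *)
Lemma first_exceedance_sum l (E : set (field R d)) :
  measurable E -> E `<=` field0 ->
  (\sum_(k : torus) P ([set w | E (shift (rep l - rep k) (Y w))] `&`
                       [set w | first_exceedance k (Y w)]) = P [set w | E (Y w)])%E.
Proof.
move=> mE E0.
pose F k := [set w | 1 < `|Y w (rep k - rep l)| /\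
  (first_exceedance k (shift (rep k - rep l) (Y w)) /\ E (Y w))].
have shiftE k : P ([set w | E (shift (rep l - rep k) (Y w))] `&`
                   [set w | first_exceedance k (Y w)]) = P (F k).
  pose h := rep l - rep k.
  have mD : measurable (first_exceedance k `&` shift h @^-1` E).
    apply: measurableI; first exact: measurable_first_exceedance.
    by apply: measurable_preimageT => //; exact: measurable_shift.
  have hN : rep k - rep l = - h by rewrite opprB.
  transitivity (P [set w | 1 < `|Y w h| /\ (first_exceedance k `&` shift h @^-1` E) (Y w)]).
    congr (P _); apply/seteqP; split=> w /=; last by tauto.
    by move=> [Ew fw]; split=> //; have := E0 _ Ew; rewrite /field0/= shift_at0.
  rewrite bal//; congr (P _); rewrite /F hN.
  by apply/seteqP; split=> w /=; rewrite shiftNK.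
under eq_bigr do rewrite shiftE.
have firstE k w : first_exceedance k (shift (rep k - rep l) (Y w)) <->
    forall j : torus, (enum_rank j < enum_rank k)%N -> ~ 1 < `|Y w (rep j - rep l)|.
  have e (j : torus) : shift (rep k - rep l) (Y w) (rep j - rep k) = Y w (rep j - rep l).
    by rewrite /shift addrA subrK.
  by split=> [fk j jk|fk j jk]; have := fk j jk; rewrite /= e.
rewrite -measure_bigcup_finType.
- congr (P _); apply/seteqP; split=> [w [k _ [_ []//]]|w Ew].
  have l0 : 1 < `|Y w (rep l - rep l)| by rewrite subrr; exact: Y_field0.
  pose Q (k : torus) := 1 < `|Y w (rep k - rep l)|.
  case: (arg_minnP (P := Q) (fun k : torus => enum_rank k : nat) l0) => k Qk kmin.
  exists k => //; split=> //; split=> //; apply/firstE => j jk Qj.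
  by have := kmin j Qj; rewrite leqNgt jk.
- move=> k; apply: measurableI; first exact: (measurable_RV Y (measurable_exceed 1 _)).
  apply: measurableI; last exact: measurable_RV.
  apply: measurable_RV_preimage; first exact: measurable_shift.
  exact: measurable_first_exceedance.
- move=> k1 k2 _ _ [w [[Q1 [/firstE f1 _]] [Q2 [/firstE f2 _]]]].
  apply: enum_rank_inj; apply/val_inj => /=.
  by case: (ltngtP (enum_rank k1) (enum_rank k2)) => // [/f2|/f1].
Qed.

End TorusLaw.

Section TorusLawProperties.
Local Open Scope classical_set_scope.
Local Open Scope ring_scope.
Context {R : realType} {d : nat} {dT : measure_display} {T : measurableType dT}.
Context (P : probability T R) (Y : {RV P >-> field R d}) (N : nat).

Local Notation torus := 'rV['I_N.+2]_d.
Implicit Types (l k : torus) (x y : field R d).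

Lemma card_torus : #|{: torus}| = (N.+2 ^ d)%N.
Proof. by rewrite card_mx card_ord mul1n. Qed.

Definition periodize b l k (w : T) : field R d := scale b (torus_field l k (Y w)).

Lemma measurable_periodize b l k : measurable_fun setT (periodize b l k).
Proof.
apply: (measurableT_comp (measurable_scale b)).
by apply: measurableT_comp => //; exact: measurable_torus_field.
Qed.

Lemma measurable_first_exceedance_RV k : measurable [set w | first_exceedance k (Y w)].
Proof. by apply: measurable_RV; exact: measurable_first_exceedance. Qed.

(** The sum over all [l] makes the law stationary; the restriction to
    [first_exceedance k] makes every periodic configuration count once, however
    many exceedances it has. *)
Definition torus_law (b : R) : {measure set (field R d) -> \bar R} :=
  fin_msum (fun lk : torus * torus =>
    law_on P (measurable_periodize b lk.1 lk.2) (measurable_first_exceedance_RV lk.2)).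

Lemma torus_lawE b A : torus_law b A =
  (\sum_(l : torus) \sum_(k : torus) P ([set w | A (periodize b l k w)] `&`
                      [set w | first_exceedance k (Y w)]))%E.
Proof. by rewrite pair_big. Qed.

(** Translating by [h] permutes the classes [l]. *)
Lemma torus_law_shift b h A :
  torus_law b (shift h @^-1` A) = torus_law b A.
Proof.
rewrite !torus_lawE [RHS](reindex_inj (addIr (proj N h))); apply: eq_bigr => l _ /=.
apply: eq_bigr => k _; congr (P (_ `&` _)).
suff e w : shift h (periodize b l k w) = periodize b (l + proj N h) k w.
  by apply/seteqP; split=> w /=; rewrite e.
apply/funext => i; rewrite /shift /periodize /scale /torus_field projD.
by rewrite [proj N i + _]addrC addrA.
Qed.

Lemma torus_law_mass b : (torus_law b setT <= ((N.+2 ^ d) ^ 2)%:R%:E)%E.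
Proof.
rewrite torus_lawE; apply: (@le_trans _ _ (\sum_(l : torus) \sum_(k : torus) 1%E)%E).
  apply: lee_sum => l _; apply: lee_sum => k _.
  rewrite setTI; apply: probability_le1; exact: measurable_first_exceedance_RV.
by rewrite pair_big/= sumEFin lee_fin sumr_const card_prod card_torus.
Qed.

Context (alpha : R).
Hypothesis Y_field0 : forall w, field0 (Y w).
Hypothesis bal : shift_balanced Y.
Hypothesis hom : tail_homogeneous Y alpha.

(** Only the value at the origin matters, and it is not affected by the
    periodization; so the tail is exact, with one copy of [Y] for each class. *)
Lemma torus_law_tail (b u : R) : 0 < b -> b <= u ->
  torus_law b [set x | u < `|x 0|] = ((N.+2 ^ d)%:R * (u / b) `^ (- alpha))%:E.
Proof.
move=> b0 bu; have ub : 1 <= u / b by rewrite ler_pdivlMr ?mul1r.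
rewrite torus_lawE.
have inner l : (\sum_(k : torus) P ([set w | (u < `|periodize b l k w 0|)%R] `&`
    [set w | first_exceedance k (Y w)]) = ((u / b) `^ (- alpha))%:E)%E.
  have mE : measurable [set x : field R d | u / b < `|x 0|] by exact: measurable_exceed.
  rewrite -(tail_homogeneous_pareto hom ub).
  rewrite -(first_exceedance_sum Y_field0 bal l mE).
    apply: eq_bigr => k _; congr (P (_ `&` _)).
    apply/seteqP; split=> w /=; rewrite shift_at0 /periodize /scale /torus_field;
      by rewrite proj0 addr0 normrM (gtr0_norm b0) ltr_pdivrMr// mulrC.
  by move=> x /=; apply: le_lt_trans.
under eq_bigr do rewrite inner.
by rewrite sumEFin sumr_const card_torus mulr_natl.
Qed.

(** For an interior class, the box of radius [m] around it stays in the fundamental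
    domain, where the periodized field is a translate of [Y]; the other
    classes are discarded. *)
Lemma torus_law_tail_ge (m : nat) (b u : R) C : 0 < b -> b <= u ->
  measurable C -> box_local m C ->
  ((#|interior d N m|%:R * (u / b) `^ (- alpha))%:E * P [set w | C (Y w)] <=
   torus_law b ([set x | C (scale u^-1 x)] `&` [set x | (u < `|x 0|)%R]))%E.
Proof.
move=> b0 bu mC Cm; have ub : 1 <= u / b by rewrite ler_pdivlMr ?mul1r.
have ub0 : 0 < u / b by exact: lt_le_trans ub.
pose D := [set x : field R d | u / b < `|x 0|] `&` [set x | C (scale (u / b)^-1 x)].
have mD : measurable D.
  apply: measurableI; first exact: measurable_exceed.
  by apply: measurable_preimageT => //; exact: measurable_scale.
pose G := [set x | C (scale u^-1 x)] `&` [set x : field R d | u < `|x 0|].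
have inner l : l \in interior d N m ->
    (\sum_(k : torus) P ([set w | G (periodize b l k w)] `&`
    [set w | first_exceedance k (Y w)]) = ((u / b) `^ (- alpha))%:E * P [set w | C (Y w)])%E.
  move=> li; rewrite -(hom ub mC).
  rewrite -(first_exceedance_sum Y_field0 bal l mD); last first.
    by move=> x [/= xub _]; apply: le_lt_trans xub.
  apply: eq_bigr => k _; congr (P (_ `&` _)).
  have loc w i : in_box m i ->
      scale u^-1 (periodize b l k w) i = scale (u / b)^-1 (shift (rep l - rep k) (Y w)) i.
    move=> im; rewrite /scale /periodize /torus_field /scale /shift.
    by rewrite (rep_interior li im) mulrA invfM invrK; congr (_ * Y w _); rewrite addrAC [RHS]addrC.
  have tail w : (u < `|periodize b l k w 0|) = (u / b < `|shift (rep l - rep k) (Y w) 0|).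
    rewrite shift_at0 /periodize /scale /torus_field.
    by rewrite proj0 addr0 normrM (gtr0_norm b0) ltr_pdivrMr// mulrC.
  apply/seteqP; split=> w /=; rewrite /D/G/= tail => -[].
    by move=> Cw tw; split=> //; apply: Cm Cw => i im; exact: loc.
  by move=> tw Cw; split=> //; apply: Cm Cw => i im; rewrite loc.
rewrite torus_lawE (bigID (mem (interior d N m)))/=.
rewrite (eq_bigr (fun=> ((u / b) `^ (- alpha))%:E * P [set w | C (Y w)])%E); last first.
  by move=> l; exact: inner.
rewrite big_const EFinM -muleA.
set c := (((u / b) `^ (- alpha))%:E * P [set w | C (Y w)])%E.
have c0 : (0 <= c)%E.
  by apply: mule_ge0; [rewrite lee_fin; exact: powR_ge0|exact: measure_ge0].
have -> : iter #|interior d N m| (adde c) 0%E = (#|interior d N m|%:R%:E * c)%E.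
  elim: #|_| => [|n IH] /=; first by rewrite mul0e.
  by rewrite IH -[in RHS]add1n natrD EFinD ge0_muleDl ?mul1e// lee_fin.
rewrite leeDl//.
by apply: sume_ge0 => l _; apply: sume_ge0 => k _; exact: measure_ge0.
Qed.

End TorusLawProperties.

(** * Mixtures of periodized fields *)

Section SlowSequence.
Local Open Scope classical_set_scope.
Local Open Scope ring_scope.
Context (R : realType) (d : nat).

(** A side that tends to infinity so slowly that the volume of the torus is
    [o(j)]: the exponent is [d + 1] where the volume has [d]. *)
Definition slow (j : nat) : nat := \max_(i < j.+1 | (i.+2 ^ d.+1 <= j.+1)%N) i.

Lemma slow_ge K j : (K.+2 ^ d.+1 <= j.+1)%N -> (K <= slow j)%N.
Proof.
move=> Kj; have Kj' : (K < j.+1)%N.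
  by apply: leq_trans Kj; rewrite expnS; apply: leq_trans (leq_pmulr _ _); rewrite ?expn_gt0.
exact: (@leq_bigmax_cond _ (fun i : 'I_j.+1 => (i.+2 ^ d.+1 <= j.+1)%N)
         (fun i : 'I_j.+1 => i : nat) (Ordinal Kj') Kj).
Qed.

Lemma slow_le j : ((slow j).+2 ^ d.+1 <= j.+1 + 2 ^ d.+1)%N.
Proof.
rewrite /slow; apply: (big_ind (fun m => (m.+2 ^ d.+1 <= j.+1 + 2 ^ d.+1)%N)).
- by rewrite leq_addl.
- by move=> a b ha hb; case: (leqP a b).
- by move=> i ij; exact: leq_trans ij (leq_addr _ _).
Qed.

Lemma slow_cvg : slow j @[j --> \oo] --> \oo.
Proof.
move=> A [M _ MA]; exists (M.+2 ^ d.+1)%N => // j /= Mj; apply: MA.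
by apply: slow_ge; exact: leq_trans Mj (leqnSn _).
Qed.

Lemma harmonic_slow_cvg : ((slow j).+1%:R^-1 : R) @[j --> \oo] --> (0 : R).
Proof. exact: (cvg_comp _ _ slow_cvg (@cvg_harmonic R)). Qed.

Definition volume (j : nat) : nat := ((slow j).+2 ^ d)%N.

Lemma volume_cvg : (volume j)%:R / j.+1%:R @[j --> \oo] --> (0 : R).
Proof.
pose c : R := 1 + (2 ^ d.+1)%:R.
apply: (@squeeze_cvgr _ _ _ _ (cst 0) (fun j => c * (slow j).+1%:R^-1)).
- apply: nearW => j; rewrite /= divr_ge0//=.
  rewrite ler_pdivrMr ?ltr0n// mulrAC ler_pdivlMr ?ltr0n//.
  have h := slow_le j; rewrite expnSr -/(volume j) in h.
  apply: (@le_trans _ _ (j.+1%:R + (2 ^ d.+1)%:R)).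
    rewrite -natrM -natrD ler_nat; apply: leq_trans h.
    by rewrite leq_mul2l leqnSn orbT.
  rewrite /c mulrDl mul1r lerD2l ler_peMr ?ler0n//.
  by rewrite ler1n.
- exact: cvg_cst.
- by rewrite -[X in _ --> X](mulr0 c); apply: cvgM; [exact: cvg_cst|exact: harmonic_slow_cvg].
Qed.

Definition interior_fraction (m j : nat) : R :=
  #|interior d (slow j) m|%:R / (volume j)%:R.

Lemma interior_fraction_le1 m j : interior_fraction m j <= 1.
Proof.
rewrite /interior_fraction ler_pdivrMr ?ltr0n ?expn_gt0// mul1r ler_nat.
by rewrite /volume -(@card_torus d (slow j)) max_card.
Qed.

Lemma interior_fraction_cvg m : interior_fraction m j @[j --> \oo] --> (1 : R).
Proof.
pose y j : R := 1 - m.*2%:R * (slow j).+1%:R^-1.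
have y1 : y j @[j --> \oo] --> (1 : R).
  rewrite -[X in _ --> X]subr0; apply: cvgB; first exact: cvg_cst.
  rewrite -[X in _ --> X](mulr0 m.*2%:R).
  by apply: cvgM; [exact: cvg_cst|exact: harmonic_slow_cvg].
pose z j : R := ((slow j).+2 - m.*2)%:R / (slow j).+2%:R.
have z1 : z j @[j --> \oo] --> (1 : R).
  apply: (@squeeze_cvgr _ _ _ _ y (cst 1)) => //; last exact: cvg_cst.
  apply: nearW => j; apply/andP; split; last first.
    by rewrite /z ler_pdivrMr ?ltr0n// mul1r ler_nat leq_subr.
  rewrite /y /z ler_pdivlMr ?ltr0n// mulrBl mul1r lerBlDr.
  apply: (@le_trans _ _ (((slow j).+2 - m.*2)%:R + m.*2%:R)).
    by rewrite -natrD ler_nat; lia.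
  rewrite lerD2l -mulrA ler_peMr//.
  by rewrite mulrC ler_pdivlMr ?ltr0n// mul1r ler_nat.
apply: (@squeeze_cvgr _ _ _ _ (fun j => z j ^+ d) (cst 1)); last exact: cvg_cst.
  apply: nearW => j; rewrite interior_fraction_le1 andbT.
  rewrite /z /interior_fraction expr_div_n -!natrX.
  rewrite ler_pM2r ?invr_gt0 ?ltr0n ?expn_gt0// ler_nat.
  exact: card_interior.
rewrite -[X in _ --> X](expr1n _ d).
exact: (continuous_cvg _ (@exprn_continuous R d 1) z1).
Qed.

(** The part of the mixture above a level at which [n] pieces are active that is
    known to come from translates of [Y]: the numerator adds up
    the proportions of interior classes, and the term [2 * volume n] bounds the pieces not yet active. *)
Definition dominance (m n : nat) : R :=
  (\sum_(0 <= j < n) interior_fraction m j) / (n%:R + 2 * (volume n)%:R).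

(** The mean of the interior fractions tends to 1 with them, and the volume is
    negligible with respect to the number of pieces. *)
Lemma dominance_cvg m : dominance m n @[n --> \oo] --> (1 : R).
Proof.
rewrite -cvg_shiftS.
have ces := cesaro (interior_fraction_cvg m).
have vol : (volume n.+1)%:R / n.+2%:R @[n --> \oo] --> (0 : R).
  by have := volume_cvg; rewrite -(cvg_shiftS (fun j => (volume j)%:R / j.+1%:R : R)).
pose v n : R := (volume n.+1)%:R / n.+1%:R.
have v0 : v n @[n --> \oo] --> (0 : R).
  apply: (@squeeze_cvgr _ _ _ _ (cst 0) (fun n => 2 * ((volume n.+1)%:R / n.+2%:R))).
  - apply: nearW => n; rewrite /= divr_ge0//= /v mulrA.
    rewrite ler_pdivrMr ?ltr0n// mulrAC ler_pdivlMr ?ltr0n//.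
    rewrite [2 * _]mulrC -mulrA ler_wpM2l// -natrM ler_nat.
    by rewrite mul2n -addnn; lia.
  - exact: cvg_cst.
  - by rewrite -[X in _ --> X](mulr0 2); apply: cvgM; [exact: cvg_cst|].
have den : 1 + 2 * v n @[n --> \oo] --> (1 + 2 * 0 : R).
  by apply: cvgD; [exact: cvg_cst|apply: cvgM => //; exact: cvg_cst].
rewrite mulr0 addr0 in den.
have ratio : arithmetic_mean (interior_fraction m) n * (1 + 2 * v n)^-1 @[n --> \oo] --> (1 * 1^-1 : R).
  by apply: cvgM => //; apply: cvgV => //; exact: oner_neq0.
rewrite invr1 mulr1 in ratio.
apply: cvg_trans ratio; apply: near_eq_cvg; apply: nearW => n.
have n0 : (n.+1%:R : R) != 0 by rewrite pnatr_eq0.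
rewrite /= /dominance /arithmetic_mean /v /series/=.
have -> : n.+1%:R + 2 * (volume n.+1)%:R = n.+1%:R * (1 + 2 * ((volume n.+1)%:R / n.+1%:R)) :> R.
  by rewrite mulrDr mulr1 mulrCA [n.+1%:R * _]mulrC divfK.
by rewrite [in RHS]invfM [RHS]mulrA; congr (_ * _); rewrite mulrC.
Qed.

End SlowSequence.

Section Mixture.
Local Open Scope classical_set_scope.
Local Open Scope ring_scope.
Context {R : realType} {d : nat} {dT : measure_display} {T : measurableType dT}.
Context (P : probability T R) (Y : {RV P >-> field R d}).
Context (alpha : R) (alpha_gt0 : 0 < alpha).

(** [level j] is the [alpha]-th power of the [radius j] by which the [j]-th torus
    field is stretched.  The factor [volume j] makes the [j]-th piece, whose
    mass is at most [volume j / level j], summable with ratio 1/2. *)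
Definition level (j : nat) : R := (2 ^ j * volume d j)%:R.

Definition radius (j : nat) : R := level j `^ alpha^-1.

Lemma volume_gt0 j : (0 < volume d j)%N. Proof. by rewrite expn_gt0. Qed.

Lemma level_gt0 j : 0 < level j.
Proof. by rewrite ltr0n muln_gt0 expn_gt0 volume_gt0. Qed.

Lemma weight_ge0 j : 0 <= ((volume d j)%:R * level j)^-1 :> R.
Proof. by rewrite invr_ge0 mulr_ge0 ?ler0n// ltW ?level_gt0. Qed.

(** The weight gives each piece the same tail [u `^ - alpha] at the levels
    [u >= radius j]. *)
Definition piece (j : nat) : {measure set (field R d) -> \bar R} :=
  mscale (NngNum (weight_ge0 j)) (torus_law Y (slow d j) (radius j)).

Definition mixture : {measure set (field R d) -> \bar R} := mseries piece 0.

Lemma mixtureE A : mixture A = (\sum_(0 <= j <oo) piece j A)%E. Proof. by []. Qed.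

Lemma mixture_shift h A : mixture (shift h @^-1` A) = mixture A.
Proof.
rewrite !mixtureE; apply: eq_eseriesr => j _.
by rewrite /piece /= /mscale/= torus_law_shift.
Qed.

Lemma piece_mass j A : measurable A -> (piece j A <= (2 ^ j)%:R^-1%:E)%E.
Proof.
move=> mA; apply: (@le_trans _ _ (piece j setT)).
  by apply: le_measure; rewrite ?inE.
rewrite /piece /= /mscale/=.
have c0 := weight_ge0 j.
apply: (@le_trans _ _ (((volume d j)%:R * level j)^-1%:E * ((volume d j) ^ 2)%:R%:E)%E).
  by rewrite lee_wpmul2l ?lee_fin//; exact: torus_law_mass.
rewrite -EFinM lee_fin /level.
have V0 : ((volume d j)%:R : R) != 0 by rewrite pnatr_eq0 -lt0n volume_gt0.
have q0 : ((2 ^ j)%:R : R) != 0 by rewrite pnatr_eq0 expn_eq0.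
rewrite (_ : _ * _ = (2 ^ j)%:R^-1)// natrX natrM expr2.
by field; rewrite V0 q0.
Qed.

Lemma tail_mass_sum n : (\sum_(n <= j <oo) (2 ^ j)%:R^-1%:E = (2 / (2 ^ n)%:R)%:E :> \bar R)%E.
Proof.
rewrite -nneseries_addn//; apply/cvg_lim => //.
have := @cvg_geometric_eseries_half R 2 n; rewrite -natrX; apply: cvg_trans.
apply: near_eq_cvg; apply: nearW => k; apply: eq_bigr => i _.
by rewrite addnS expnS natrM invfM mulrA divff ?mul1r.
Qed.

Lemma radius_gt0 j : 0 < radius j. Proof. by rewrite powR_gt0 ?level_gt0. Qed.

Lemma radiusK j : radius j `^ alpha = level j.
Proof. by rewrite -powRrM mulVf ?gt_eqF// powRr1// ltW ?level_gt0. Qed.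

Lemma radius_le j u : 0 < u -> level j <= u `^ alpha -> radius j <= u.
Proof.
move=> u0 ju; rewrite leNgt; apply/negP => uj.
have := gt0_ltr_powR alpha_gt0 (ltW u0 : u \in Num.nneg)
  (ltW (radius_gt0 j) : radius j \in Num.nneg) uj.
by rewrite radiusK ltNge ju.
Qed.

Lemma tail_scaling j u : 0 < u -> (u / radius j) `^ (- alpha) = level j * u `^ (- alpha).
Proof.
move=> u0; have b0 := radius_gt0 j.
have uE : u `^ alpha = (u / radius j) `^ alpha * level j.
  by rewrite -(radiusK j) -powRM ?divr_ge0 ?ltW// divfK ?gt_eqF.
by rewrite !powRN uE invfM mulrCA divff ?mulr1// gt_eqF ?level_gt0.
Qed.

Hypothesis Y_field0 : forall w, field0 (Y w).
Hypothesis bal : shift_balanced Y.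
Hypothesis hom : tail_homogeneous Y alpha.

Lemma piece_tail j u : 0 < u -> level j <= u `^ alpha ->
  piece j [set x | u < `|x 0|] = (u `^ (- alpha))%:E.
Proof.
move=> u0 ju; rewrite /piece /= /mscale/=.
rewrite (torus_law_tail _ Y_field0 bal hom (radius_gt0 j) (radius_le u0 ju)).
rewrite tail_scaling// -/(volume d j) -EFinM; congr EFin.
have V0 : ((volume d j)%:R : R) != 0 by rewrite pnatr_eq0 -lt0n volume_gt0.
by rewrite [X in _ * X]mulrA mulKf// mulf_neq0// gt_eqF ?level_gt0.
Qed.

Lemma piece_tail_ge m j u C : 0 < u -> level j <= u `^ alpha ->
  measurable C -> box_local m C ->
  ((interior_fraction R d m j * u `^ (- alpha))%:E * P [set w | C (Y w)] <=
   piece j ([set x | C (scale u^-1 x)] `&` [set x | (u < `|x 0|)%R]))%E.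
Proof.
move=> u0 ju mC Cm; rewrite /piece /= /mscale/=.
have := torus_law_tail_ge _ Y_field0 bal hom (radius_gt0 j) (radius_le u0 ju) mC Cm.
move=> /(_ (slow d j)) le.
apply: le_trans (lee_wpmul2l _ le); last by rewrite lee_fin weight_ge0.
rewrite muleA -EFinM lee_wpmul2r// lee_fin /= tail_scaling// le_eqVlt.
apply/orP; left; apply/eqP; rewrite /interior_fraction.
have V0 : ((volume d j)%:R : R) != 0 by rewrite pnatr_eq0 -lt0n volume_gt0.
have q0 : ((2 ^ j)%:R : R) != 0 by rewrite pnatr_eq0 expn_eq0.
by field; rewrite V0 q0.
Qed.

(** The [n] active pieces have tail [u `^ - alpha] each; the others have total mass
    [2 / 2 ^ n], that is [2 * volume n / level n], and [level n] exceeds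
    [u `^ alpha]. *)
Lemma mixture_tail_le u n : 0 < u -> (forall j, (j < n)%N -> level j <= u `^ alpha) ->
  u `^ alpha < level n ->
  (mixture [set x | (u < `|x 0|)%R] <=
   (u `^ (- alpha) * (n%:R + 2 * (volume d n)%:R))%:E)%E.
Proof.
move=> u0 low high.
have mU : measurable [set x : field R d | u < `|x 0|] by exact: measurable_exceed.
rewrite mixtureE (nneseries_split 0 n)// add0n mulrDr EFinD; apply: leeD.
  rewrite big_mkord (eq_bigr (fun=> (u `^ (- alpha))%:E)); last first.
    by move=> j _; apply: piece_tail => //; apply: low.
  by rewrite sumEFin sumr_const card_ord mulr_natr.
apply: (@le_trans _ _ (\sum_(n <= j <oo) (2 ^ j)%:R^-1%:E)%E).
  by apply: lee_nneseries => // j _; exact: piece_mass.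
rewrite tail_mass_sum lee_fin mulrCA ler_pM2l//.
have ua : 0 < u `^ alpha by rewrite powR_gt0.
rewrite powRN ler_pdivlMl// mulrC ler_pdivrMl ?ltr0n ?expn_gt0//.
by rewrite -natrM ltW.
Qed.

Lemma mixture_tail_ge m u n C : 0 < u -> (forall j, (j < n)%N -> level j <= u `^ alpha) ->
  measurable C -> box_local m C ->
  ((u `^ (- alpha) * \sum_(0 <= j < n) interior_fraction R d m j)%:E * P [set w | C (Y w)] <=
   mixture ([set x | C (scale u^-1 x)] `&` [set x | (u < `|x 0|)%R]))%E.
Proof.
move=> u0 low mC Cm; rewrite mixtureE.
apply: le_trans (nneseries_lim_ge n _) => //.
rewrite mulr_sumr -sumEFin ge0_sume_distrl; last first.
  move=> j _; rewrite lee_fin mulr_ge0 ?powR_ge0//.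
  by rewrite divr_ge0.
rewrite big_nat [leRHS]big_nat; apply: lee_sum => j /= jn.
by rewrite mulrC; apply: piece_tail_ge => //; exact: low.
Qed.

End Mixture.

Section CoordinateField.
Local Open Scope classical_set_scope.
Context (R : realType) (d : nat).

(** A separate constant, to carry the structure of measurable function. *)
Definition coordinate_field : field R d -> field R d := fun x => x.

HB.instance Definition _ := @isMeasurableFun.Build _ _ _ _ coordinate_field
  (@measurable_id _ (field R d) setT).

End CoordinateField.

Section Existence.
Local Open Scope classical_set_scope.
Local Open Scope ring_scope.
Context {R : realType} {d : nat} {dT : measure_display} {T : measurableType dT}.
Context (P : probability T R) (Y : {RV P >-> field R d}).
Context (alpha : R) (alpha_gt0 : 0 < alpha).
Hypothesis Y_field0 : forall w, field0 (Y w).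
Hypothesis bal : shift_balanced Y.
Hypothesis hom : tail_homogeneous Y alpha.

Local Notation mix := (mixture Y alpha).
Local Notation lev := (level (R := R) (d := d)).

(** The count [n_ u] of active pieces stops at the first level above
    [u `^ alpha]; it is unbounded because each level is eventually exceeded. *)
Lemma crossing_index : exists n_ : R -> nat,
  (forall u, u `^ alpha < lev (n_ u) /\ (forall j, (j < n_ u)%N -> lev j <= u `^ alpha)) /\
  n_ u @[u --> +oo] --> \oo.
Proof.
have ex u : exists n, u `^ alpha < lev n.
  exists (Num.bound (u `^ alpha)).
  apply: lt_le_trans (archi_boundP (powR_ge0 _ _)) _.
  rewrite ler_nat (leq_trans (ltnW (ltn_expl _ (ltnSn 1))))//.
  by rewrite leq_pmulr// volume_gt0.
exists (fun u => ex_minn (ex u)); split=> [u|].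
  case: ex_minnP => n un nmin; split=> // j jn; rewrite leNgt; apply/negP => uj.
  by have := nmin _ uj; rewrite leqNgt jn.
move=> A [K _ KA].
have : \forall u \near +oo, \sum_(j < K) @radius R d alpha j <= u.
  by apply: nbhs_pinfty_ge; exact: num_real.
apply: filterS => u Ku; apply: KA => /=.
case: ex_minnP => n un _; rewrite leqNgt; apply/negP => nK.
have nu : @radius R d alpha n <= u.
  apply: le_trans Ku; rewrite (bigD1 (Ordinal nK))//= lerDl.
  by apply: sumr_ge0 => i _; exact/ltW/radius_gt0.
have := ge0_ler_powR (ltW alpha_gt0) (ltW (@radius_gt0 R d alpha n) : radius alpha n \in Num.nneg)
  (le_trans (ltW (@radius_gt0 R d alpha n)) nu : u \in Num.nneg) nu.
by rewrite radiusK// leNgt un.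
Qed.

Lemma mixture_finite : (mix setT < +oo)%E.
Proof.
apply: (@le_lt_trans _ _ 2%:E); last exact: ltry.
rewrite mixtureE; apply: (@le_trans _ _ (\sum_(0 <= j <oo) (2 ^ j)%:R^-1%:E)%E).
  by apply: lee_nneseries => // j _; exact: piece_mass.
by rewrite tail_mass_sum expn0 divr1.
Qed.

Lemma mixture_tail_gt0 (u : R) : (0 < mix [set x | (u < `|x 0|)%R])%E.
Proof.
(* beyond its radius, the first piece has a known positive tail *)
pose v := Num.max u (@radius R d alpha 0).
have b0 := @radius_gt0 R d alpha 0.
have v0 : 0 < v by rewrite lt_max b0 orbT.
have mS c : measurable [set x : field R d | c < `|x 0|] by exact: measurable_exceed.
apply: (@lt_le_trans _ _ (mix [set x | (v < `|x 0|)%R])); last first.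
  by apply: le_measure; rewrite ?inE// => x; apply: le_lt_trans; rewrite le_max lexx.
have lev0 : lev 0 <= v `^ alpha.
  rewrite -(@radiusK R d alpha alpha_gt0 0); apply: (ge0_ler_powR (ltW alpha_gt0)).
  - exact: ltW.
  - exact: ltW.
  - by rewrite le_max lexx orbT.
rewrite mixtureE; apply: lt_le_trans (nneseries_lim_ge 1 _) => //.
by rewrite big_nat1 (piece_tail alpha_gt0 Y_field0 bal hom v0 lev0) lte_fin powR_gt0.
Qed.

(** The mixture, normalized, is the law of a stationary field; the normalization
    cancels in the conditional laws. *)
Lemma exists_stationary_field :
  exists (PX : probability (field R d) R) (X : {RV PX >-> field R d}),
    stationary X /\ tail_process X Y.
Proof.
pose c := fine (mix setT).
have mixT : mix setT \is a fin_num by rewrite ge0_fin_numE// mixture_finite.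
have mixT0 : (0 < mix setT)%E.
  apply: lt_le_trans (mixture_tail_gt0 0) _.
  by apply: le_measure; rewrite ?inE//; exact: measurable_exceed.
have c0 : 0 < c by rewrite fine_gt0// mixT0 mixture_finite.
pose PX : probability (field R d) R := mnormalize mix (distribution P Y).
have PXE A : PX A = (mix A * c^-1%:E)%E.
  rewrite /PX /= /mnormalize; case: ifPn => // /orP[/eqP m0|/eqP m1].
    by rewrite m0 ltxx in mixT0.
  by rewrite m1 in mixT.
pose X : {RV PX >-> field R d} := @coordinate_field R d.
exists PX, X; split.
  by move=> k A mA; rewrite !PXE; congr (_ * _)%E; exact: mixture_shift.
have pos u : (0 < PX [set w | (u < `|X w 0|)%R])%E.
  by rewrite PXE mule_gt0 ?mixture_tail_gt0// lte_fin invr_gt0.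
split=> //.
  rewrite -(probability_setT P); congr (P _).
  by apply/seteqP; split=> // w _; exact: Y_field0.
move=> m f cf bf.
have [n_ [n_cross n_cvg]] := crossing_index.
pose r u := dominance R d m (n_ u).
apply: (@tail_limit_of_minorization R d _ _ PX X _ _ P Y m r) => //.
  exact: (cvg_comp _ _ n_cvg (@dominance_cvg R d m)).
near=> u; have u0 : 0 < u by near: u; exact: nbhs_pinfty_gt.
have [high low] := n_cross u.
have V0 : 0 < (n_ u)%:R + 2 * (volume d (n_ u))%:R :> R.
  by rewrite ltr_wpDl// mulr_gt0// ltr0n volume_gt0.
have K0 : 0 <= \sum_(0 <= j < n_ u) interior_fraction R d m j.
  by apply: sumr_ge0 => j _; rewrite divr_ge0.
have r0 : 0 <= r u by rewrite divr_ge0// ltW.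
split=> // C mC Cm; rewrite !PXE.
rewrite muleA (muleAC _ _ (P _)); apply: lee_wpmul2r; first by rewrite lee_fin invr_ge0 ltW.
apply: le_trans (mixture_tail_ge alpha_gt0 Y_field0 bal hom u0 low mC Cm).
apply: lee_wpmul2r => //.
apply: le_trans (lee_wpmul2l _ (mixture_tail_le alpha_gt0 Y_field0 bal hom u0 low high)) _.
  by rewrite lee_fin.
rewrite -EFinM lee_fin /r /dominance mulrCA -mulrA mulVf ?mulr1// gt_eqF//.
Unshelve. all: by end_near. Qed.

End Existence.

Local Open Scope ring_scope.

(** * The characterization *)

Theorem corollary2p11 (R : realType) (d : nat) (d_gt0 : (0 < d)%N)
    (alpha : R) (alpha_gt0 : 0 < alpha)
    (dT : measure_display) (T : measurableType dT) (P : probability T R)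
    (Y : {RV P >-> field R d}) (Y_field0 : forall w, field0 (Y w)) :
  (exists (dX : measure_display) (TX : measurableType dX)
          (PX : probability TX R) (X : {RV PX >-> field R d}),
      regularly_varying alpha X /\ tail_process X Y)
  <->
  [/\ exceedance_stationary Y,
      pareto P alpha (fun w => `|Y w 0|) &
      independent P (fun w => `|Y w 0|) (spectral Y)].
Proof.
split=> [[dX [TX [PX [X [[stat [dY [TY [PY [Y' [tp' par']]]]]] tp]]]]]|[es par ind]].
  (* the Pareto law is given for another tail process of [X], which has the same law *)
  have par : pareto P alpha (fun w => `|Y w 0|).
    move=> y y1; rewrite -(par' y y1); apply/esym.
    exact: (tail_process_same_law tp tp' (measurable_exceed y 0)).
  have hom := tail_process_tail_homogeneous Y_field0 tp par.
  split=> //; last exact: tail_homogeneous_independent hom.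
  apply: (shift_balanced_exceedance_stationary Y_field0).
  exact: tail_process_shift_balanced Y_field0 tp stat.
have bal := exceedance_stationary_shift_balanced Y_field0 es.
have hom := pareto_independent_tail_homogeneous Y_field0 par ind.
have [PX [X [stat tp]]] := exists_stationary_field alpha_gt0 Y_field0 bal hom.
by do 4!eexists; split; [split; [exact: stat|do 4!eexists; split; [exact: tp|exact: par]]|exact: tp].
Qed.
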